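(* Let $t$ be a seed satisfying the full rank assumption, $k\in I_{uf}$ and $t'=\mu_kt$, with tropical transformation $\phi=\phi_{t',t}$. Let $z\in LP(t)\cap LP(t')$, and let $\mathcal S=\{s_g\mid g\in M^\circ(t)\}\subset LP(t)\cap LP(t')$ be such that each $s_g$ is pointed at $g$ in $LP(t)$ and pointed at $\phi(g)$ in $LP(t')$. Let $z=\sum_{g\in M^\circ(t)}\alpha_t(z)(g)\,s_g$ be the $\prec_t$-decomposition of $z$ into elements of $\mathcal S$ and $z=\sum_{g\in M^\circ(t)}\alpha_{t'}(z)(\phi(g))\,s_g$ the $\prec_{t'}$-decomposition of $z$ into elements of $\mathcal S$. Then $\alpha_t(z)(g)=\alpha_{t'}(z)(\phi(g))$ for all $g\in M^\circ(t)$. In particular, $\phi(\mathrm{supp}(\alpha_t(z)))=\mathrm{supp}(\alpha_{t'}(z))$.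
   Context: Conventions: $[a]_+=\max(a,0)$, $\mathbb N=\mathbb Z_{\ge 0}$; $\Bbbk=\mathbb Z$ (classical case) or $\Bbbk=\mathbb Z[q^{\pm1/2}]$ (quantum case). Fix a finite set $I=I_{uf}\sqcup I_{f}$ (unfrozen, frozen) and integers $d_i>0$. A seed $t=((b_{ij}(t))_{i,j\in I},(x_i(t))_{i\in I})$ has $b_{ij}d_j=-b_{ji}d_i$, $b_{ij}\in\mathbb Q$ if $i,j\in I_f$ and $b_{ij}\in\mathbb Z$ otherwise, and indeterminates $x_i(t)$. $\tilde B(t)=(b_{ik}(t))_{i\in I,k\in I_{uf}}$. Full rank assumption: $\tilde B(t)$ has rank $|I_{uf}|$ (preserved by mutation). $M^\circ(t)=\mathbb Z^I$ with basis $f_i$; $LP(t)=\Bbbk[M^\circ(t)]$ with basis of Laurent monomials $x(t)^m$, $x_i=x^{f_i}$. Mutation: for $k\in I_{uf}$, $t'=\mu_kt$ has $b'_{ij}=-b_{ij}$ if $k\in\{i,j\}$ and $b'_{ij}=b_{ij}+b_{ik}[b_{kj}]_++[-b_{ik}]_+b_{kj}$ otherwise; $\mu_k^*$ identifies the (skew-)fields of fractions $\mathcal F(t')\simeq\mathcal F(t)$ by $x_i'\mapsto x_i$ ($i\neq k$), $x_k'\mapsto x^{-f_k+\sum_j[-b_{jk}]_+f_j}+x^{-f_k+\sum_j[b_{jk}]_+f_j}$; $LP(t)\cap LP(t')$ is taken under this identification. In the quantum case, $M^\circ(t)$ carries a skew-symmetric $\mathbb Z$-valued form $\lambda$ with $\lambda(f_i,\tilde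 B(t)e_k)=-\delta_{ik}d_k'$ ($d_k'>0$ integers), $LP(t)$ has the product $x^m*x^{m'}=q^{\lambda(m,m')/2}x^{m+m'}$, and $\lambda$ is transported to $\mu_kt$ via $f_i'\mapsto f_i$, $f_k'\mapsto-f_k+\sum_j[-b_{jk}]_+f_j$. Tropical transformation $\phi_{\mu_kt,t}:M^\circ(t)\to M^\circ(\mu_kt)$: $g'_k=-g_k$, $g_i'=g_i+[b_{ik}]_+[g_k]_+-[-b_{ik}]_+[-g_k]_+$ ($i\neq k$). Dominance order: $g'\preceq_tg$ iff $g'=g+\tilde B(t)n$, $n\in\mathbb N^{I_{uf}}$. $z\in LP(t)$ is pointed at $g$ if $g$ is the unique $\prec_t$-maximal Laurent degree of $z$ and the coefficient of $x^g$ is $1$. Formal Laurent series: $\widehat{LP(t)}$ is the set of formal sums $\sum c_gx(t)^g$ ($c_g\in\Bbbk$) whose support is contained in a finite union of sets $g^{(j)}+\tilde B(t)\mathbb N^{I_{uf}}$. Dominance order decomposition: for $\mathcal S=\{s_g\mid g\in M^\circ(t)\}$ with $s_g\in\widehat{LP(t)}$ pointed at $g$, every $z\in\widehat{LP(t)}$ has a unique (possibly infinite, coefficientwise well-defined) expression $z=\sum_{g\in M^\circ(t)}\alpha_t(z)(g)s_g$ in $\widehat{LP(t)}$, where $\alpha_t(z):M^\circ(t)\to\Bbbk$ is a function whose support $\mathrm{supp}(\alpha_t(z))=\{g\mid\alpha_t(z)(g)\ne0\}$ has finitely many $\prec_t$-maximal elements (every element of the support being dominated by one of them). This is the $\prec_t$-decomposition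 of $z$ into elements of $\mathcal S$. The $\prec_{t'}$-decomposition is the same notion for the seed $t'$, with $s_g$ regarded as the element of $\mathcal S$ pointed at $\phi(g)\in M^\circ(t')$ and $\alpha_{t'}(z):M^\circ(t')\to\Bbbk$. *)

(* Defs.v *)
From HB Require Import structures.
From mathcomp Require Import all_boot all_order all_algebra finmap.
From mathcomp Require Import boolp classical_sets functions cardinality fsbigop.
From mathcomp Require Import monalg.

Set Implicit Arguments.
Unset Strict Implicit.
Unset Printing Implicit Defensive.

Import Order.TTheory GRing.Theory Num.Theory.

Local Open Scope classical_set_scope.
Local Open Scope ring_scope.

(** * Group algebras twisted by a bicharacter *)

Record bicharacter (K : comNzRingType) (M : zmodType) := Bicharacter {
  bichar :> M -> M -> K;
  bichar0l : forall b, bichar 0 b = 1;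
  bichar0r : forall a, bichar a 0 = 1;
  bicharDl : forall a a' b, bichar (a + a') b = bichar a b * bichar a' b;
  bicharDr : forall a b b', bichar a (b + b') = bichar a b * bichar a b' }.

(* The free K-module on M; the phantom argument chi determines the product
   x^a * x^b = chi(a, b) x^(a + b) installed below (the library's own product
   on malg is only available over monoids without invertible elements). *)
Definition twisted (K : comNzRingType) (M : zmodType)
  (chi : bicharacter K M) : Type := {malg K[M]}.

HB.instance Definition _ (K : comNzRingType) (M : zmodType)
  (chi : bicharacter K M) := GRing.Lmodule.copy (twisted chi) {malg K[M]}.

Section TwistedRing.
Variables (K : comNzRingType) (M : zmodType) (chi : bicharacter K M).
Local Notation A := (twisted chi).

Definition lin_ext (V : lmodType K) (h : M -> V) (z : {malg K[M]}) : V :=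
  \sum_(a <- msupp z) mcoeff a z *: h a.

Lemma lin_extEw (V : lmodType K) (h : M -> V) (z : {malg K[M]}) (D : {fset M}) :
  fsubset (msupp z) D -> lin_ext h z = \sum_(a <- D) mcoeff a z *: h a.
Proof.
move=> sD; rewrite /lin_ext; apply: big_fset_incl => // a aD /mcoeff_outdom ->.
by rewrite scale0r.
Qed.

Lemma lin_ext_is_linear (V : lmodType K) (h : M -> V) : linear (lin_ext h).
Proof.
move=> c y z; set D := (msupp y `|` msupp z)%fset.
have sy : fsubset (msupp y) D by exact: fsubsetUl.
have sz : fsubset (msupp z) D by exact: fsubsetUr.
have scyz : fsubset (msupp (c *: y + z)) D.
  apply/fsubsetP => a; rewrite -mcoeff_neq0 mcoeffD mcoeffZ in_fsetU.
  case: msuppP => //= _; case: msuppP => //= _.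
  by rewrite mulr0 addr0 eqxx.
rewrite (lin_extEw h sy) (lin_extEw h sz) (lin_extEw h scyz).
rewrite scaler_sumr -big_split /=; apply: eq_bigr => a _.
by rewrite mcoeffD mcoeffZ scalerDl scalerA.
Qed.

HB.instance Definition _ (V : lmodType K) (h : M -> V) :=
  GRing.isLinear.Build K {malg K[M]} V *:%R (lin_ext h) (lin_ext_is_linear h).

Lemma lin_extU (V : lmodType K) (h : M -> V) c a :
  lin_ext h (mkmalgU a c) = c *: h a.
Proof. by rewrite (lin_extEw h msuppU_le) big_seq_fset1 mcoeffUU. Qed.

Definition tw_one : A := mkmalgU 0 1.

Definition tw_mul (y z : A) : A :=
  lin_ext (fun a : M => lin_ext (fun b : M =>
    mkmalgU (a + b) (chi a b) : {malg K[M]}) z) y.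

Lemma scaleU (c d : K) (a : M) :
  c *: (mkmalgU a d : {malg K[M]}) = mkmalgU a (c * d).
Proof. by apply/malgP => b; rewrite mcoeffZ !mcoeffU mulrnAr. Qed.

Lemma tw_mulUU c a d b :
  tw_mul (mkmalgU a c) (mkmalgU b d) = mkmalgU (a + b) (c * d * chi a b).
Proof. by rewrite /tw_mul !lin_extU !scaleU mulrA. Qed.

Lemma tw_mulDl : left_distributive tw_mul +%R.
Proof. by move=> x y z; rewrite /tw_mul raddfD. Qed.

Lemma tw_mulZl c x y : tw_mul (c *: x) y = c *: tw_mul x y.
Proof. by rewrite /tw_mul linearZ_LR. Qed.

Lemma tw_mul_linr x : linear (tw_mul x).
Proof.
move=> c y z; rewrite /tw_mul /lin_ext scaler_sumr -big_split /=.
apply: eq_bigr => a _; rewrite -!/(lin_ext _ _) linearP /= scalerDr.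
by rewrite !scalerA mulrC.
Qed.

Lemma tw_mulDr : right_distributive tw_mul +%R.
Proof. by move=> x y z; have := tw_mul_linr x 1 y z; rewrite !scale1r. Qed.

Lemma tw_mulZr c x y : tw_mul x (c *: y) = c *: tw_mul x y.
Proof.
have := tw_mul_linr x c y 0; rewrite !addr0 => ->.
by have /= := tw_mul_linr x (-1) 0 0; rewrite scaler0 addr0 scaleN1r addNr
  => ->; rewrite addr0.
Qed.

Lemma tw_ind (P : A -> Prop) : P 0 -> (forall c y z, P y -> P z -> P (c *: y + z)) ->
  (forall a, P (mkmalgU a 1)) -> forall z, P z.
Proof.
move=> P0 PD PU z; rewrite [z]monalgE; elim/big_ind: _ => //.
  by move=> x y Px Py; rewrite -[x]scale1r; apply: PD.
move=> a _; rewrite -[X in mkmalgU a X]mulr1 -scaleU -[_ *: _]addr0.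
exact: PD.
Qed.

Lemma tw_mul0l x : tw_mul 0 x = 0.
Proof. by rewrite -[0 in LHS](scale0r 0) tw_mulZl scale0r. Qed.

Lemma tw_mul0r x : tw_mul x 0 = 0.
Proof. by rewrite -[0 in LHS](scale0r 0) tw_mulZr scale0r. Qed.

Lemma tw_mul1l : left_id tw_one tw_mul.
Proof.
elim/tw_ind => [|c y z Py Pz|a]; first exact: tw_mul0r.
  by rewrite tw_mulDr tw_mulZr Py Pz.
by rewrite tw_mulUU add0r bichar0l !mulr1.
Qed.

Lemma tw_mul1r : right_id tw_one tw_mul.
Proof.
elim/tw_ind => [|c y z Py Pz|a]; first exact: tw_mul0l.
  by rewrite tw_mulDl tw_mulZl Py Pz.
by rewrite tw_mulUU addr0 bichar0r !mulr1.
Qed.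

Lemma tw_mulA : associative tw_mul.
Proof.
move=> + y z; elim/tw_ind => [|c x x' Px Px'|a].
- by rewrite !tw_mul0l.
- by rewrite !tw_mulDl !tw_mulZl Px Px'.
elim/tw_ind: y => [|c x x' Px Px'|b].
- by rewrite !(tw_mul0l, tw_mul0r).
- by rewrite !(tw_mulDl, tw_mulZl, tw_mulDr, tw_mulZr) Px Px'.
elim/tw_ind: z => [|c x x' Px Px'|d].
- by rewrite !tw_mul0r.
- by rewrite !(tw_mulDr, tw_mulZr) Px Px'.
rewrite !tw_mulUU addrA bicharDl bicharDr !mul1r !mulr1; congr mkmalgU.
by rewrite mulrC mulrA.
Qed.

Lemma tw_mulC : (forall a b, chi a b = chi b a) -> commutative tw_mul.
Proof.
move=> chiC + y; elim/tw_ind => [|c x x' Px Px'|a].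
- by rewrite tw_mul0l tw_mul0r.
- by rewrite tw_mulDl tw_mulDr tw_mulZl tw_mulZr Px Px'.
elim/tw_ind: y => [|c x x' Px Px'|b].
- by rewrite tw_mul0l tw_mul0r.
- by rewrite tw_mulDl tw_mulDr tw_mulZl tw_mulZr Px Px'.
by rewrite !tw_mulUU addrC chiC.
Qed.

Lemma tw_one_neq0 : tw_one != 0.
Proof. by rewrite monalgU_eq0 oner_eq0. Qed.

HB.instance Definition _ := GRing.Zmodule_isNzRing.Build A
  tw_mulA tw_mul1l tw_mul1r tw_mulDl tw_mulDr tw_one_neq0.

Lemma tw_scalerAl c (x y : A) : c *: (x * y) = (c *: x) * y.
Proof. by rewrite [RHS]tw_mulZl. Qed.

HB.instance Definition _ := GRing.Lmodule_isLalgebra.Build K A tw_scalerAl.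

End TwistedRing.

(** * Scalars: the classical and the quantum case *)

Section TrivialBicharacter.
Variables (K : comNzRingType) (M : zmodType).

Lemma mul11 : 1 = 1 * 1 :> K. Proof. by rewrite mulr1. Qed.

Definition trivial_bichar : bicharacter K M :=
  @Bicharacter K M (fun _ _ => 1) (fun _ => erefl) (fun _ => erefl)
    (fun _ _ _ => mul11) (fun _ _ _ => mul11).

End TrivialBicharacter.

(* Z[q^(1/2), q^(-1/2)]: the group algebra of Z, where the basis element of
   index n is q^(n/2). *)
Definition Zq : Type := twisted (trivial_bichar int int).

HB.instance Definition _ := GRing.NzRing.on Zq.

Lemma Zq_mulC : commutative ( *%R : Zq -> Zq -> Zq).
Proof. by apply: (tw_mulC (chi := trivial_bichar int int)). Qed.

HB.instance Definition _ := GRing.PzRing_hasCommutativeMul.Build Zq Zq_mulC.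

Variant setting := Classical | Quantum.

Definition scalars (c : setting) : comNzRingType :=
  match c with Classical => int | Quantum => Zq end.

(* n |-> q^(n/2), with q = 1 in the classical case. *)
Definition q_half (c : setting) : int -> scalars c :=
  match c with
  | Classical => fun _ => 1
  | Quantum => fun n => mkmalgU n 1
  end.

Lemma q_half0 c : q_half c 0 = 1. Proof. by case: c. Qed.

Lemma q_halfD c m n : q_half c (m + n) = q_half c m * q_half c n.
Proof.
case: c => /=; first by rewrite mulr1.
by rewrite [RHS]tw_mulUU !mulr1.
Qed.

(** * Seeds *)

Definition posp (R : realDomainType) (x : R) : R := Num.max x 0.

Definition lattice (Iuf If : finType) : zmodType := {ffun Iuf + If -> int}.

Definition f_ (Iuf If : finType) (i : Iuf + If) : lattice Iuf If :=
  [ffun j => (j == i)%:Z].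

(* inl marks the unfrozen and inr the frozen indices.  The form lam is given by
   its Gram matrix in the basis f_i; it is part of the data of a quantum seed,
   and plays no role in the classical case, where q = 1. *)
Record seed (Iuf If : finType) := Seed {
  bmx : Iuf + If -> Iuf + If -> rat;
  lam : Iuf + If -> Iuf + If -> int }.

Definition frozen (Iuf If : finType) (i : Iuf + If) : bool :=
  if i is inr _ then true else false.

Section Seeds.
Variables (Iuf If : finType).
Local Notation I := (Iuf + If)%type.
Local Notation M := (lattice Iuf If).
Implicit Types (t : seed Iuf If) (k : Iuf) (g m : M).

(* b_ij as an integer; only meaningful (and only used) when i or j is
   unfrozen, in which case b_ij is integral. *)
Definition bint t (i j : I) : int := Num.floor (bmx t i j).

Definition bcol t k : M := [ffun i => bint t i (inl k)].

Definition Btilde t (n : {ffun Iuf -> nat}) : M := \sum_(k : Iuf) bcol t k *+ n k.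

Definition full_rank t : Prop :=
  \rank (\matrix_(i < #|{: I}|, k < #|Iuf|)
           bmx t (enum_val i) (inl (enum_val k))) = #|Iuf|.

Definition lform (L : I -> I -> int) (m m' : M) : int :=
  \sum_(i : I) \sum_(j : I) m i * L i j * m' j.

Definition compatible t : Prop :=
  (forall i j, lam t i j = - lam t j i) /\
  exists d' : Iuf -> nat, forall k, (0 < d' k)%N /\
    forall i, lform (lam t) (f_ i) (bcol t k) = - ((i == inl k)%:Z * (d' k)%:Z).

Definition is_seed (c : setting) (d : I -> nat) t : Prop :=
  [/\ forall i j, bmx t i j * (d j)%:R = - bmx t j i * (d i)%:R,
      forall i j, ~~ (frozen i && frozen j) -> bmx t i j \is a Num.int
    & c = Quantum -> compatible t].

(* -f_k + \sum_j [s b_jk]_+ f_j, for a sign s *)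
Definition exchange_exp t k (s : int) : M :=
  - f_ (inl k) + \sum_(j : I) f_ j *~ posp (s * bint t j (inl k)).

Definition mutate_basis t k (i : I) : M :=
  if i == inl k then exchange_exp t k (-1) else f_ i.

Definition mutate k t : seed Iuf If :=
  {| bmx := fun i j =>
       if (i == inl k) || (j == inl k) then - bmx t i j
       else bmx t i j + bmx t i (inl k) * posp (bmx t (inl k) j)
            + posp (- bmx t i (inl k)) * bmx t (inl k) j;
     lam := fun i j => lform (lam t) (mutate_basis t k i) (mutate_basis t k j) |}.

(* the map phi from the lattice of t to the lattice of mu_k t *)
Definition tropical t k g : M :=
  [ffun i => if i == inl k then - g (inl k)
     else g i + posp (bint t i (inl k)) * posp (g (inl k))
              - posp (- bint t i (inl k)) * posp (- g (inl k))].

Definition dominated t g' g : Prop := exists n, g' = g + Btilde t n.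

Lemma dominated_refl t g : dominated t g g.
Proof.
exists [ffun=> 0%N]; rewrite /Btilde big1 ?addr0 // => k _.
by rewrite ffunE mulr0n.
Qed.

Definition dom_maximal t (A : set M) : set M :=
  [set g | A g /\ forall h, A h -> dominated t g h -> h = g].

(** * Laurent polynomials and formal Laurent series *)

Lemma lformDl L : forall a a' b, lform L (a + a') b = lform L a b + lform L a' b.
Proof.
move=> a a' b; rewrite /lform -big_split; apply: eq_bigr => i _.
by rewrite -big_split; apply: eq_bigr => j _; rewrite ffunE /= !mulrDl.
Qed.

Lemma lformDr L : forall a b b', lform L a (b + b') = lform L a b + lform L a b'.
Proof.
move=> a b b'; rewrite /lform -big_split; apply: eq_bigr => i _.
by rewrite -big_split; apply: eq_bigr => j _; rewrite ffunE /= !mulrDr.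
Qed.

Lemma lform0l L b : lform L 0 b = 0.
Proof. by apply: (addrI (lform L 0 b)); rewrite -lformDl !addr0. Qed.

Lemma lform0r L a : lform L a 0 = 0.
Proof. by apply: (addrI (lform L a 0)); rewrite -lformDr !addr0. Qed.

Section LaurentRing.
Variables (c : setting) (t : seed Iuf If).

Let lambda (a b : M) : scalars c := q_half c (lform (lam t) a b).

Fact lambda0l b : lambda 0 b = 1.
Proof. by rewrite /lambda lform0l q_half0. Qed.
Fact lambda0r a : lambda a 0 = 1.
Proof. by rewrite /lambda lform0r q_half0. Qed.
Fact lambdaDl a a' b : lambda (a + a') b = lambda a b * lambda a' b.
Proof. by rewrite /lambda lformDl q_halfD. Qed.
Fact lambdaDr a b b' : lambda a (b + b') = lambda a b * lambda a b'.
Proof. by rewrite /lambda lformDr q_halfD. Qed.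

(* (m, m') |-> q^(lambda(m, m')/2) *)
Definition torus_bichar : bicharacter (scalars c) M :=
  Bicharacter lambda0l lambda0r lambdaDl lambdaDr.

Definition LP : lalgType (scalars c) := twisted torus_bichar.

Definition coef (z : LP) (m : M) : scalars c := @mcoeff M (scalars c) m z.

Definition xpow (m : M) : LP := mkmalgU m 1.

Lemma xpowM a b :
  xpow a * xpow b = q_half c (lform (lam t) a b) *: xpow (a + b).
Proof. by rewrite [LHS]tw_mulUU /xpow [RHS]scaleU !mul1r mulr1. Qed.

(* [dominated t m g] says that m belongs to g + Btilde(t) N^Iuf *)
Record series := Series {
  scoef :> M -> scalars c;
  scoefP : exists gs : seq M,
    forall m, scoef m != 0 -> exists2 g, g \in gs & dominated t m g }.

Fact coef_support (z : LP) : exists gs : seq M,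
  forall m, coef z m != 0 -> exists2 g, g \in gs & dominated t m g.
Proof.
exists (msupp (z : {malg (scalars c)[M]})) => m; rewrite mcoeff_neq0 => zm.
by exists m => //; exact: dominated_refl.
Qed.

Definition LP_series (z : LP) : series := Series (coef_support z).

Definition supp (a : M -> scalars c) : set M := [set m | a m != 0].

Definition pointed (z : series) g : Prop :=
  [/\ dom_maximal t (supp z) g,
      forall h, dom_maximal t (supp z) h -> h = g
    & z g = 1].

(* z = \sum_(g : J) a (deg g) * s g, coefficientwise, where deg g : M is the
   degree of s g with respect to t. *)
Definition dominance_decomposition (J : choiceType) (deg : J -> M)
    (s : J -> series) (z : series) (a : M -> scalars c) : Prop :=
  [/\ finite_set (dom_maximal t (supp a)),
      forall g, supp a g -> exists2 h, dom_maximal t (supp a) h & dominated t g h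
    & forall m, finite_set [set g | a (deg g) * s g m != 0] /\
                z m = \sum_(g \in [set: J]) a (deg g) * s g m].

End LaurentRing.
End Seeds.

(** * Fraction skew-fields and the identification by mutation *)

Record skew_fractions (A : nzRingType) := SkewFractions {
  frac_sort :> unitRingType;
  frac_in : {rmorphism A -> frac_sort};
  frac_unit : forall x : frac_sort, x != 0 -> x \is a GRing.unit;
  frac_inj : injective frac_in;
  fracE : forall x : frac_sort,
    exists a b : A, b != 0 /\ x = frac_in a / frac_in b }.

Section Mutation.
Variables (c : setting) (Iuf If : finType) (t : seed Iuf If) (k : Iuf).
Local Notation t' := (mutate k t).
Variables (F : skew_fractions (LP c t)) (F' : skew_fractions (LP c t')).

(* mu_k^* : F(t') -> F(t) *)
Record mutation_iso := MutationIso {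
  mut_fun :> {rmorphism F' -> F};
  mut_bij : bijective mut_fun;
  mut_scalar : forall a : scalars c, mut_fun (frac_in F' a%:A) = frac_in F a%:A;
  mut_x : forall i : Iuf + If, i != inl k ->
    mut_fun (frac_in F' (xpow c t' (f_ i))) = frac_in F (xpow c t (f_ i));
  mut_xk : mut_fun (frac_in F' (xpow c t' (f_ (inl k)))) =
    frac_in F (xpow c t (exchange_exp t k (-1)) + xpow c t (exchange_exp t k 1)) }.

(* Elements of LP(t) \cap LP(t'): an element of LP(t) and an element of LP(t')
   with the same image in F(t). *)
Record LP_cap (mu : mutation_iso) := LPCap {
  in_LP : LP c t;
  in_LP' : LP c t';
  LP_capE : mu (frac_in F' in_LP') = frac_in F in_LP }.

End Mutation.

(* Main.v *)
(* Write p_i for the i-th column of B~(t), e_-, e_+ = e_- + p_k for the two exponents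
   of the exchange relation and X = x^(e_-) + x^(e_+), so that x_k' = X.  By full rank
   there is an additive l on M with l(p_k) = 0 and l(p_i) > 0 for i <> k; mutation
   preserves the l-grading and negates the x_k-degree, so the intersection of LP(t) and LP(t')
   contains the graded components of its elements, and degrees below g in either
   dominance order differ from g by multiples of p_k when they lie on the l-level of g.
   Comparing extremal terms after multiplication by powers of X, the lowest level of
   s_g is x^g when g_k >= 0 and x'^phi(g) when g_k <= 0.  On the lowest level of z,
   alpha(g) for g_k >= 0 and alpha'(phi(g)) for g_k <= 0 are thus Laurent coefficients
   of z, hence finitely many; subtracting the corresponding finite combination of the
   s_g leaves an element whose lowest level has x_k-degrees < 0 in t and x_k'-degrees
   <= 0 in t', so that this level is zero.  Therefore alpha and alpha' o phi agree
   there with finite support, and one subtracts and passes to the next level. *)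
Require Import Defs.
From HB Require Import structures.
From mathcomp Require Import all_boot all_order all_algebra finmap.
From mathcomp Require Import boolp classical_sets functions cardinality fsbigop.
From mathcomp Require Import monalg zify ring.

Set Implicit Arguments.
Unset Strict Implicit.
Unset Printing Implicit Defensive.

Import Order.TTheory GRing.Theory Num.Theory.

Local Open Scope classical_set_scope.
Local Open Scope ring_scope.

(** * Expansions and dominance *)

Section Expansion.
Variables (K : comNzRingType) (J M : choiceType) (s : J -> M -> K).

(** At each degree the sum is over any finite set containing the nonzero terms, so expansions
    combine by taking unions. *)
Definition expands (b : J -> K) (z : M -> K) : Prop :=
  forall m, exists S : {fset J}, (forall j, j \notin S -> b j * s j m = 0) /\
    z m = \sum_(j <- S) b j * s j m.

Lemma expands_single b z m j : expands b z ->
  (forall i, i != j -> b i * s i m = 0) -> z m = b j * s j m.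
Proof.
move=> /(_ m)[S [S0 ->]] b0.
rewrite (big_fset_incl _ (fsubsetUl S [fset j]%fset)); last by move=> i _ /S0.
rewrite (big_fsetD1 j) ?inE ?eqxx ?orbT //= big_seq big1 ?addr0 // => i.
by rewrite !inE => /andP[ij _]; exact: b0.
Qed.

Lemma expands_zero b z m : expands b z ->
  (forall i, b i * s i m = 0) -> z m = 0.
Proof. by move=> /(_ m)[S [_ ->]] b0; rewrite big1. Qed.

Lemma expandsB b1 z1 b2 z2 : expands b1 z1 -> expands b2 z2 ->
  expands (fun j => b1 j - b2 j) (fun m => z1 m - z2 m).
Proof.
move=> e1 e2 m; have [S1 [S10 ->]] := e1 m; have [S2 [S20 ->]] := e2 m.
exists (S1 `|` S2)%fset; split.
  move=> j; rewrite !inE negb_or => /andP[/S10 b1j /S20 b2j].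
  by rewrite mulrBl b1j b2j subrr.
rewrite (big_fset_incl _ (fsubsetUl S1 S2)); last by move=> i _ /S10.
rewrite [X in _ - X](big_fset_incl _ (fsubsetUr S1 S2)); last by move=> i _ /S20.
by rewrite -sumrB; apply: eq_bigr => i _; rewrite mulrBl.
Qed.

Lemma expands_finite (S : {fset J}) (b : J -> K) :
  expands (fun j => if j \in S then b j else 0)
    (fun m => \sum_(j <- S) b j * s j m).
Proof.
move=> m; exists S; split => [j /negbTE ->|]; first by rewrite mul0r.
by rewrite !big_seq; apply: eq_bigr => j ->.
Qed.

(** Unitriangularity: at [deg j] only [j] and indices of no higher level and strictly smaller rank
    contribute. On the lowest level these stay on that level, and the rank is bounded below on the
    support, so induction on the rank applies. *)
Lemma expansion_unique b z (deg : J -> M) (lev rk : J -> int) L B :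
  (forall j, s j (deg j) = 1) ->
  (forall i j, i != j -> s i (deg j) != 0 -> lev i <= lev j /\ rk i < rk j) ->
  expands b z ->
  (forall j, b j != 0 -> L <= lev j) -> (forall j, b j != 0 -> B <= rk j) ->
  (forall j, lev j = L -> z (deg j) = 0) ->
  forall j, lev j = L -> b j = 0.
Proof.
move=> s1 slt ez bL bB z0.
suff main n j : lev j = L -> rk j < B + n%:Z -> b j = 0.
  by move=> j jL; apply: (main (absz (rk j - B + 1)%R)) => //; lia.
elim: n j => [|n IH] j jL jn.
  by apply/eqP; apply: contraTT jn => /bB; rewrite addr0 -leNgt.
have : z (deg j) = b j * s j (deg j).
  apply: expands_single ez _ => i ij.
  have [->|bi] := eqVneq (b i) 0; first by rewrite mul0r.
  have [->|/(slt _ _ ij)[lij rij]] := eqVneq (s i (deg j)) 0; first by rewrite mulr0.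
  rewrite IH ?mul0r //; last lia.
  by apply/eqP; rewrite eq_le -{1}jL lij bL.
by rewrite z0 // s1 mulr1.
Qed.

End Expansion.

(** * Dominance order and additive functionals *)

Section Dominance.
Variables (Iuf If : finType) (t : seed Iuf If).
Local Notation M := (lattice Iuf If).

Section Functional.
Variable w : {additive M -> int}.

Lemma additive_Btilde n : w (Btilde t n) = \sum_i w (bcol t i) * (n i)%:Z.
Proof.
by rewrite /Btilde raddf_sum; apply: eq_bigr => i _; rewrite raddfMn -mulr_natr natz.
Qed.

Lemma dominated_le m g : (forall i, 0 <= w (bcol t i)) ->
  dominated t m g -> w g <= w m.
Proof.
move=> w0 [n ->]; rewrite raddfD lerDl additive_Btilde.
by apply: sumr_ge0 => i _; rewrite mulr_ge0.
Qed.

Lemma dominated_level k m g : w (bcol t k) = 0 ->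
  (forall i, i != k -> 0 < w (bcol t i)) ->
  dominated t m g -> w m = w g -> exists n, m = g + bcol t k *+ n.
Proof.
move=> w0 wgt [n ->]; rewrite raddfD => /eqP.
rewrite -subr_eq0 addrC addKr additive_Btilde psumr_eq0; last first.
  move=> i _; have [->|/wgt/ltW] := eqVneq i k; last by move=> ?; rewrite mulr_ge0.
  by rewrite w0 mul0r.
move=> /allP n0; exists (n k); congr (_ + _).
rewrite /Btilde (bigD1 k) //= big1 ?addr0 // => i ik.
have := n0 i (mem_index_enum i); rewrite mulf_eq0 gt_eqF ?wgt //=.
by move=> /eqP[->].
Qed.

(** A functional positive on all columns strictly increases on going down in the dominance order,
    which makes the order antisymmetric. *)
Lemma dominated_eq m g : (forall i, 0 < w (bcol t i)) ->
  dominated t m g -> w m <= w g -> m = g.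
Proof.
move=> wgt [n ->]; rewrite raddfD gerDl additive_Btilde => le0.
have : \sum_i w (bcol t i) * (n i)%:Z == 0.
  by rewrite eq_le le0 sumr_ge0 // => i _; rewrite mulr_ge0 ?(ltW (wgt i)).
rewrite psumr_eq0 => [/allP n0|i _]; last by rewrite mulr_ge0 ?(ltW (wgt i)).
rewrite /Btilde big1 ?addr0 // => i _.
have := n0 i (mem_index_enum i); rewrite mulf_eq0 gt_eqF ?wgt //=.
by move=> /eqP[->].
Qed.

End Functional.

Lemma dominated_trans a b g : dominated t a b -> dominated t b g -> dominated t a g.
Proof.
move=> [n ->] [n' ->]; exists [ffun i => (n' i + n i)%N].
rewrite -addrA; congr (_ + _); rewrite /Btilde -big_split /=.
by apply: eq_bigr => i _; rewrite ffunE mulrnDr.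
Qed.

Variable c : setting.

(** The support is finite, so among its degrees dominating [m] there is one with least [r]; it is
    maximal, hence equal to [g]. *)
Lemma pointed_dominated (r : {additive M -> int}) (z : LP c t) g m :
  (forall i, 0 < r (bcol t i)) ->
  pointed (LP_series z) g -> coef z m != 0 -> dominated t m g.
Proof.
move=> rgt [_ gmax _] zm.
pose D := [fset h in msupp (z : {malg (scalars c)[M]}) | `[< dominated t m h >]]%fset.
have mD : m \in D.
  by rewrite !inE -mcoeff_neq0 zm; apply/asboolP/dominated_refl.
case: (arg_minP (fun h : D => r (val h)) (isT : xpredT [` mD]%fset)) => h _ hmin.
have := valP h; rewrite !inE -mcoeff_neq0 => /andP[zh /asboolP mh].
have /gmax <- // : dom_maximal t (supp (LP_series z)) (val h).
split => // h' zh' hh'.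
have h'D : h' \in D.
  by rewrite !inE -mcoeff_neq0 zh'; apply/asboolP/(dominated_trans mh hh').
by have /= := hmin [` h'D]%fset isT => /(dominated_eq rgt hh').
Qed.

(** Every degree of the support lies below one of finitely many maximal ones, and [w] does not
    decrease on going down. *)
Lemma decomposition_bounded (w : {additive M -> int}) (J : choiceType)
    (deg : J -> M) s z a : (forall i, 0 <= w (bcol t i)) ->
  @dominance_decomposition Iuf If c t J deg s z a ->
  exists B, forall g, a g != 0 -> B <= w g.
Proof.
move=> w0 [fmax amax _].
pose B := - \sum_(h <- fset_set (dom_maximal t (supp a))) `|w h|.
exists B => g /amax[h hmax /(dominated_le w0)]; apply: le_trans.
rewrite lerNl (le_trans (ler_norm _)) // normrN (big_fsetD1 h) //=; last first.
  by rewrite in_fset_set // inE.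
by rewrite lerDl sumr_ge0.
Qed.

Lemma decomposition_expands (J : choiceType) (deg : J -> M) s z a :
  @dominance_decomposition Iuf If c t J deg s z a ->
  expands (fun j => scoef (s j)) (a \o deg) (scoef z).
Proof.
move=> [_ _ H] m; have [fin ->] := H m.
exists (fset_set [set g | a (deg g) * s g m != 0]); split.
  move=> j; rewrite in_fset_set // => /negP jS.
  by apply/eqP/negPn/negP => nz; apply: jS; rewrite inE.
apply: fsbigTE => j; rewrite in_fset_set // => /negP jS.
by apply/eqP/negPn/negP => nz; apply: jS; rewrite inE.
Qed.

End Dominance.

(** * Degree lattice *)

Section DualFunctionals.
Variables (Iuf If : finType) (t : seed Iuf If).
Local Notation M := (lattice Iuf If).

Definition pairing (L : Iuf + If -> int) (m : M) : int := \sum_i L i * m i.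

Lemma pairing_is_zmod_morphism L : zmod_morphism (pairing L).
Proof.
move=> x y; rewrite /pairing -sumrB; apply: eq_bigr => i _.
by rewrite !ffunE mulrBr.
Qed.

HB.instance Definition _ L :=
  GRing.isZmodMorphism.Build M int (pairing L) (pairing_is_zmod_morphism L).

Lemma common_denominator (I J : finType) (A : I -> J -> rat) :
  exists2 D : nat, (0 < D)%N & forall i j, D%:R * A i j \is a Num.int.
Proof.
exists (\prod_i \prod_j `|denq (A i j)|)%N.
  by rewrite prodn_gt0 // => i; rewrite prodn_gt0 // => j; rewrite absz_gt0 denq_eq0.
move=> i j; rewrite (bigD1 i) //= (bigD1 j) //= !natrM.
have -> : (`|denq (A i j)|%N)%:R = (denq (A i j))%:~R :> rat.
  by rewrite natr_absz ger0_norm // denq_ge0.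
have den0 : (denq (A i j))%:~R != 0 :> rat by rewrite intr_eq0 denq_eq0.
rewrite -[X in _ * X]divq_num_den mulrC -!mulrA mulKf //.
by rewrite !rpredM ?intr_int ?natr_int.
Qed.

Hypothesis t_int : forall i j, ~~ (frozen i && frozen j) -> bmx t i j \is a Num.int.
Hypothesis t_full : full_rank t.

Lemma bintE i j : ~~ (frozen i && frozen j) -> (bint t i j)%:~R = bmx t i j.
Proof. by move=> /t_int /floorK. Qed.

(** Full rank gives a rational left inverse of the matrix; a common denominator [D] makes its rows
    integral. *)
Lemma dual_functionals : exists2 D : int, 0 < D &
  exists L : Iuf -> Iuf + If -> int, forall k j,
    pairing (L k) (bcol t j) = D *+ (k == j).
Proof.
have /eqP/row_fullP[B BA] := t_full.
have [D D0 DB] := common_denominator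
  (fun (k : Iuf) (i : Iuf + If) => B (enum_rank k) (enum_rank i)).
exists D%:Z => //.
exists (fun k i => Num.floor (D%:R * B (enum_rank k) (enum_rank i))) => k j.
apply: (@intr_inj rat); rewrite /pairing rmorph_sum /=.
rewrite (eq_bigr (fun i => D%:R * (B (enum_rank k) (enum_rank i) * bmx t i (inl j)))).
  rewrite -mulr_sumr (reindex_onto enum_val enum_rank) /=; last first.
    by move=> i _; rewrite enum_rankK.
  have := congr1 (fun X : 'M_#|Iuf| => X (enum_rank k) (enum_rank j)) BA.
  rewrite !mxE (can_eq enum_rankK) => BAkj.
  rewrite rmorphMn /= -[RHS]mulr_natr -BAkj; congr (_ * _).
  apply: eq_big => [i|i _]; first by rewrite enum_valK eqxx.
  by rewrite enum_valK mxE enum_rankK.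
move=> i _; rewrite rmorphM /= floorK ?DB // ffunE bintE ?mulrA //.
by rewrite andbF.
Qed.

End DualFunctionals.

(** * Exponents, columns and the tropical map under mutation *)

Section Exchange.
Variables (c : setting) (Iuf If : finType) (d : Iuf + If -> nat) (t : seed Iuf If).
Variable k : Iuf.
Local Notation M := (lattice Iuf If).
Local Notation t' := (mutate k t).
Local Notation fk := (f_ (inl k) : M).

Lemma exchange_expE s j :
  exchange_exp t k s j = posp (s * bint t j (inl k)) - (j == inl k)%:Z.
Proof.
rewrite /exchange_exp addrC !ffunE; congr (_ - _).
rewrite sum_ffunE (bigD1 j) //= big1 => [|i ij].
  by rewrite addr0 ffunMzE ffunE eqxx intz.
by rewrite ffunMzE ffunE eq_sym (negbTE ij) mul0rz.
Qed.

Lemma pospB (x : int) : posp x - posp (- x) = x.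
Proof. rewrite /posp; lia. Qed.

Lemma exchange_exp1 : exchange_exp t k 1 = exchange_exp t k (-1) + bcol t k.
Proof.
apply/ffunP => j; rewrite [RHS]ffunE !exchange_expE ffunE mul1r mulN1r.
by rewrite -[X in _ = _ + X]pospB; ring.
Qed.

(* The exponent map of the substitution x_k' = x^(e_-), which is the mutation
   modulo p_k since e_+ = e_- + p_k. *)
Definition mono (m : M) : M := m - fk *~ m (inl k) + exchange_exp t k (-1) *~ m (inl k).

Lemma mono_is_zmod_morphism : zmod_morphism mono.
Proof.
move=> x y; rewrite /mono !ffunE !mulrzBr; apply/ffunP => i; rewrite !ffunE; ring.
Qed.

HB.instance Definition _ := GRing.isZmodMorphism.Build M M mono mono_is_zmod_morphism.

Hypothesis d_gt0 : forall i, (0 < d i)%N.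
Hypothesis t_seed : is_seed c d t.

Lemma bint_diag : bint t (inl k) (inl k) = 0.
Proof.
rewrite /bint; suff -> : bmx t (inl k) (inl k) = 0 by rewrite floor0.
have [/(_ (inl k) (inl k)) + _ _] := t_seed; rewrite mulNr => /eqP.
rewrite -addr_eq0 -mulr2n mulrn_eq0 mulf_eq0 pnatr_eq0 /= => /orP[/eqP//|].
by rewrite eqn0Ngt d_gt0.
Qed.

(** Packaged as an additive map so that the [x_k]-degree can serve as a grading, like the level. *)
Definition kdeg (m : M) : int := m (inl k).

Lemma kdeg_is_zmod_morphism : zmod_morphism kdeg.
Proof. by move=> x y; rewrite /kdeg !ffunE. Qed.

HB.instance Definition _ :=
  GRing.isZmodMorphism.Build M int kdeg kdeg_is_zmod_morphism.

Lemma bcol_diag : bcol t k (inl k) = 0.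
Proof. by rewrite ffunE bint_diag. Qed.

Lemma bint_mutate_k j : bint t' j (inl k) = - bint t j (inl k).
Proof.
have [_ t_int _] := t_seed.
by rewrite /bint /= eqxx orbT floorN // t_int ?andbF.
Qed.

Lemma intr_posp (x : int) : posp (x%:~R) = (posp x)%:~R :> rat.
Proof.
rewrite /posp; have [x0|/ltW x0] := leP x 0.
  by rewrite max_r // lerz0.
by rewrite max_l // ler0z.
Qed.

Lemma bint_mutate j i : i != k -> bint t' j (inl i) =
  if j == inl k then - bint t j (inl i) else
  bint t j (inl i) + bint t j (inl k) * posp (bint t (inl k) (inl i))
  + posp (- bint t j (inl k)) * bint t (inl k) (inl i).
Proof.
move=> ik; have [_ t_int _] := t_seed.
rewrite /bint /= [inl i == _](inj_eq inl_inj) (negbTE ik) orbF.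
case: ifP => [_|_]; first by rewrite floorN // t_int ?andbF.
rewrite -!(bintE t_int) ?andbF // -rmorphN /= !intr_posp -!rmorphM -!rmorphD /=.
by rewrite !intrKfloor.
Qed.

Lemma mono_bcol_k : mono (bcol t' k) = - bcol t k.
Proof.
have b0 : bcol t' k (inl k) = 0 by rewrite ffunE bint_mutate_k bint_diag oppr0.
rewrite /mono b0 !mulr0z subr0 addr0; apply/ffunP => j.
by rewrite !ffunE bint_mutate_k.
Qed.

(** The [k]-th coordinate of the mutated column is [- b_ki], so substituting [e_-] cancels the term
    [[- b_jk]_+ b_ki] of the mutation rule. Modulo [p_k] the columns of the two seeds correspond, so
    one level functional serves both. *)
Lemma mono_bcol i : i != k ->
  mono (bcol t' i) = bcol t i + bcol t k *~ posp (bint t (inl k) (inl i)).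
Proof.
move=> ik; have b0 : bcol t' i (inl k) = - bint t (inl k) (inl i).
  by rewrite ffunE bint_mutate // eqxx.
rewrite /mono b0; apply/ffunP => j; rewrite !ffunE !ffunMzE exchange_expE !ffunE.
rewrite bint_mutate // mulN1r; case: eqVneq => [->|jk] /=.
  by rewrite bint_diag /posp oppr0 maxxx; lia.
by rewrite !mulrzz; ring.
Qed.

Lemma mono_inl_k m : mono m (inl k) = - m (inl k).
Proof.
rewrite /mono !ffunE !ffunMzE exchange_expE ffunE eqxx bint_diag mulr0 /posp maxxx.
by rewrite !mulrzz /=; ring.
Qed.

Lemma tropical_inl_k (g : M) : tropical t k g (inl k) = - g (inl k).
Proof. by rewrite ffunE eqxx. Qed.

(** The tropical map is piecewise linear: it sends [f_k] to [e_+] on this half-space and acts as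
    [mono] on the opposite one. *)
Lemma tropical_pos (g : M) : 0 <= g (inl k) ->
  tropical t k g = g - fk *~ g (inl k) + exchange_exp t k 1 *~ g (inl k).
Proof.
move=> g0; apply/ffunP => j; rewrite !ffunE !ffunMzE exchange_expE ffunE mul1r.
case: eqVneq => [->|jk] /=; first by rewrite bint_diag /posp maxxx; lia.
rewrite [posp (g _)]/posp [posp (- g _)]/posp; move: (posp _) (posp _) => x y.
have -> : Num.max (g (inl k)) 0 = g (inl k) by lia.
have -> : Num.max (- g (inl k)) 0 = 0 by lia.
by rewrite !mulrzz; ring.
Qed.

Lemma tropical_neg (g : M) : g (inl k) <= 0 ->
  tropical t k g = g - fk *~ g (inl k) + exchange_exp t k (-1) *~ g (inl k).
Proof.
move=> g0; apply/ffunP => j; rewrite !ffunE !ffunMzE exchange_expE ffunE mulN1r.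
case: eqVneq => [->|jk] /=; first by rewrite bint_diag /posp oppr0 maxxx; lia.
rewrite [posp (g _)]/posp [posp (- g _)]/posp; move: (posp _) (posp _) => x y.
have -> : Num.max (g (inl k)) 0 = 0 by lia.
have -> : Num.max (- g (inl k)) 0 = - g (inl k) by lia.
by rewrite !mulrzz; ring.
Qed.

Definition tropical_inv (m : M) : M :=
  [ffun i => if i == inl k then - m (inl k)
     else m i - posp (bint t i (inl k)) * posp (- m (inl k))
              + posp (- bint t i (inl k)) * posp (m (inl k))].

Lemma tropicalK : cancel (tropical t k) tropical_inv.
Proof.
move=> g; apply/ffunP => i; rewrite !ffunE eqxx opprK.
by case: eqP => [->//|_]; ring.
Qed.

Lemma tropical_invK : cancel tropical_inv (tropical t k).
Proof.
move=> g; apply/ffunP => i; rewrite !ffunE eqxx opprK.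
by case: eqP => [->//|_]; ring.
Qed.

Lemma mono_tropical_neg (g : M) : g (inl k) <= 0 -> mono (tropical t k g) = g.
Proof.
move=> g0; rewrite /mono tropical_inl_k tropical_neg // !mulrNz.
by apply/ffunP => i; rewrite !ffunE; ring.
Qed.

Lemma mono_tropical_pos (g : M) : 0 <= g (inl k) ->
  mono (tropical t k g) = g + bcol t k *~ g (inl k).
Proof.
move=> g0; rewrite /mono tropical_inl_k tropical_pos // !mulrNz exchange_exp1.
by rewrite mulrzDl; apply/ffunP => i; rewrite !ffunE; ring.
Qed.

Lemma level_tropical (l : {additive M -> int}) g :
  l (bcol t k) = 0 -> l (mono (tropical t k g)) = l g.
Proof.
move=> l0; have [g0|/ltW g0] := lerP 0 (g (inl k)).
  by rewrite mono_tropical_pos // raddfD raddfMz l0 mul0rz addr0.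
by rewrite mono_tropical_neg.
Qed.

Hypothesis t_full : full_rank t.

(** [l] sums the dual functionals of all indices other than [k], and [r] adds that of [k]. Since
    [psi] sends [p'_k] to [- p_k], [r'] weights [p_k] negatively and compensates with a large
    multiple of [l]. *)
Lemma level_functionals : exists l r r' : {additive M -> int},
  [/\ l (bcol t k) = 0, forall i, i != k -> 0 < l (bcol t i),
      forall i, 0 < r (bcol t i) & forall i, 0 < r' (bcol t' i)].
Proof.
have [_ t_int _] := t_seed; have [D D0 [L LE]] := dual_functionals t_int t_full.
(* [[b_ki]_+] is the multiple of [p_k] occurring in [psi(p'_i)]; [C] strictly exceeds all of
   them. *)
pose C := 1 + \sum_i posp (bint t (inl k) (inl i)).
have posp_ge0 (x : int) : 0 <= posp x by rewrite /posp; lia.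
have CP i : posp (bint t (inl k) (inl i)) < C.
  rewrite /C (bigD1 i) //= addrCA ltrDl ltr_wpDr // sumr_ge0 //.
have C0 : 0 < C by apply: le_lt_trans (CP k).
pose Ll j := \sum_(i | i != k) L i j.
have lE i : pairing Ll (bcol t i) = D *+ (i != k).
  rewrite /pairing (eq_bigr (fun j => \sum_(e | e != k) L e j * bcol t i j)); last first.
    by move=> j _; rewrite mulr_suml.
  rewrite exchange_big /= (eq_bigr (fun j => D *+ (j == i))); last first.
    by move=> j _; rewrite -LE.
  have [->|ik] := eqVneq i k; first by rewrite big1 // => j /negbTE ->.
  rewrite (bigD1 i) //= eqxx big1 ?addr0 // => j /andP[_ /negbTE ->] //.
pose ll : {additive M -> int} := pairing Ll.
pose hh : {additive M -> int} := pairing (L k).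
pose r' : {additive M -> int} := (C \*o (ll \o mono)) \- (hh \o mono).
exists ll, (ll \+ hh), r'; split => [|i ik|i|i].
- by rewrite [LHS]lE eqxx.
- by rewrite [ltRHS]lE ik.
- rewrite /= [X in X + _]lE [X in _ + X]LE eq_sym.
  by case: eqP; rewrite ?addr0 ?add0r.
rewrite /r' /=; have [->|ik] := eqVneq i k.
  by rewrite mono_bcol_k !raddfN /= [X in _ * - X]lE [X in _ - - X]LE !eqxx /=; lia.
rewrite mono_bcol // !raddfD !raddfMz /= !lE !LE eqxx ik eq_sym (negbTE ik) /=.
have := CP i; move: (posp _) => x xC; rewrite mul0rz addr0 mulr0n add0r mulrzz.
by nia.
Qed.

End Exchange.

(** * Quantum tori *)

(* [LP c t] is used through this interface because conversion on the concrete type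
   unfolds the whole construction of its ring structure. *)
Record torus (K : comNzRingType) (q : int -> K) (M : zmodType) := Torus {
  torus_alg :> lalgType K;
  tform : M -> M -> int;
  tmon : M -> torus_alg;
  tcoef : torus_alg -> M -> K;
  trestrict : pred M -> torus_alg -> torus_alg;
  tcoef0 : forall m, tcoef 0 m = 0;
  tcoefD : forall y z m, tcoef (y + z) m = tcoef y m + tcoef z m;
  tcoefZ : forall a z m, tcoef (a *: z) m = a * tcoef z m;
  tcoef_mon : forall a m, tcoef (tmon a) m = (a == m)%:R;
  tcoef_restrict : forall P z m,
    tcoef (trestrict P z) m = if P m then tcoef z m else 0;
  tcoef_fin : forall z, exists S : {fset M}, forall m, tcoef z m != 0 -> m \in S;
  tcoef_inj : forall y z, (forall m, tcoef y m = tcoef z m) -> y = z;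
  torus_ind : forall P : torus_alg -> Prop, P 0 ->
    (forall a y z, P y -> P z -> P (a *: y + z)) -> (forall a, P (tmon a)) ->
    forall z, P z;
  tscalerAr : forall a (y z : torus_alg), y * (a *: z) = a *: (y * z);
  tmon0 : tmon 0 = 1;
  tmonM : forall a b, tmon a * tmon b = q (tform a b) *: tmon (a + b) }.

Section Torus.
Variables (K : comNzRingType) (q : int -> K) (M : zmodType) (A : torus q M).
Hypothesis q0 : q 0 = 1.
Hypothesis qD : forall e e', q (e + e') = q e * q e'.
Local Notation xpow := (tmon A).
Local Notation coef := (@tcoef K q M A).
Local Notation lam := (@tform K q M A).
Local Notation keep := (@trestrict K q M A).
Implicit Types (w z : A) (a b m : M).

Lemma qNK e : q (- e) * q e = 1.
Proof. by rewrite -qD addNr q0. Qed.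

(** Powers of [q] are units, so commutation factors do not affect which coefficients vanish. *)
Lemma q_eq0 e x : (q e * x == 0) = (x == 0).
Proof.
apply/eqP/eqP => [qx0|->]; last by rewrite mulr0.
by rewrite -[x]mul1r -(qNK e) -mulrA qx0 mulr0.
Qed.

Lemma tcoefB w z m : coef (w - z) m = coef w m - coef z m.
Proof. by rewrite tcoefD -scaleN1r tcoefZ mulN1r. Qed.

Lemma tcoef_sum (J : Type) (S : seq J) (z : J -> A) m :
  coef (\sum_(j <- S) z j) m = \sum_(j <- S) coef (z j) m.
Proof.
elim: S => [|j S IH]; first by rewrite !big_nil tcoef0.
by rewrite !big_cons tcoefD IH.
Qed.

Lemma lowest_term (h : {additive M -> int}) w m0 : coef w m0 != 0 ->
  exists2 m, coef w m != 0 & forall m', coef w m' != 0 -> h m <= h m'.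
Proof.
move=> w0; have [S wS] := tcoef_fin w.
pose D := [fset m in S | coef w m != 0]%fset.
have DP m : coef w m != 0 -> m \in D by move=> wm; rewrite !inE wm wS.
case: (arg_minP (fun m : D => h (val m)) (isT : xpredT [` DP _ w0]%fset)) => m _ hm.
exists (val m); first by have := valP m; rewrite !inE => /andP[].
by move=> m' /DP m'D; exact: (hm [` m'D]%fset isT).
Qed.

Lemma restrict0 P : keep P 0 = 0.
Proof. by apply: tcoef_inj => m; rewrite tcoef_restrict tcoef0 if_same. Qed.

Lemma restrictP P x w z : keep P (x *: w + z) = x *: keep P w + keep P z.
Proof.
apply: tcoef_inj => m; rewrite !(tcoef_restrict, tcoefD, tcoefZ).
by case: ifP; rewrite ?mulr0 ?addr0.
Qed.

Lemma restrict_mon P a : keep P (xpow a) = if P a then xpow a else 0.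
Proof.
apply: tcoef_inj => m; rewrite tcoef_restrict tcoef_mon.
case: eqVneq => [<-|/negbTE am]; first by case: ifP; rewrite ?tcoef_mon ?tcoef0 ?eqxx.
by rewrite if_same; case: ifP; rewrite ?tcoef_mon ?tcoef0 ?am.
Qed.

Lemma tmonD a b : xpow (a + b) = q (- lam a b) *: (xpow a * xpow b).
Proof. by rewrite tmonM scalerA qNK scale1r. Qed.

(** Reordering factors costs a power of [q]; its exponent stays existential, since only vanishing of
    coefficients is tracked later. *)
Lemma tmon_addMn a b n : exists e,
  xpow (a + b *+ n) = q e *: (xpow a * xpow b ^+ n).
Proof.
elim: n => [|n [e IH]]; first by exists 0; rewrite mulr0n addr0 mulr1 q0 scale1r.
exists (- lam (a + b *+ n) b + e).
by rewrite mulrSr addrA tmonD IH -scalerAl scalerA -qD -mulrA -exprSr.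
Qed.

Lemma tcoef_mulr_mon w a m :
  coef (w * xpow a) m = q (lam (m - a) a) * coef w (m - a).
Proof.
elim/torus_ind: w => [|x w z IHw IHz|b]; first by rewrite mul0r !tcoef0 mulr0.
  by rewrite mulrDl -scalerAl !(tcoefD, tcoefZ) IHw IHz mulrDr mulrCA.
rewrite tmonM tcoefZ !tcoef_mon eq_sym -subr_eq eq_sym.
by case: eqP => [->|]; rewrite ?mulr0.
Qed.

(** * Multiplication by powers of a binomial *)

Section Binomial.
Variables (w1 w2 : M).
Local Notation X := (xpow w1 + xpow w2).

Lemma coef_mul_binomial w m : coef (w * X) m =
  q (lam (m - w1) w1) * coef w (m - w1) +
  q (lam (m - w2) w2) * coef w (m - w2).
Proof. by rewrite mulrDr tcoefD !tcoef_mulr_mon. Qed.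

Variable h : {additive M -> int}.

(** As [h w1 < h w2], the lowest part of the product arises only by choosing [x^w1] in every
    factor. *)
Lemma coef_mul_binomial_lowest w B n : h w1 < h w2 ->
  (forall m, h m < B -> coef w m = 0) -> forall m, h m <= B + h w1 *+ n ->
  exists e, coef (w * X ^+ n) m =
    if h m == B + h w1 *+ n then q e * coef w (m - w1 *+ n) else 0.
Proof.
move=> h12 wB; elim: n => [|n IH] m.
  rewrite !mulr0n !addr0 mulr1 subr0 le_eqVlt => /orP[/eqP->|hm].
    by exists 0; rewrite eqxx q0 mul1r.
  by exists 0; rewrite lt_eqF ?wB.
move=> hm; rewrite exprSr mulrA coef_mul_binomial.
have hm1 : h (m - w1) <= B + h w1 *+ n by rewrite raddfB lerBlDr -addrA -mulrSr.
have hm2 : h (m - w2) < B + h w1 *+ n.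
  by rewrite raddfB ltrBlDr (le_lt_trans hm) // mulrSr addrA ltrD2l.
have [e ->] := IH _ hm1; have [e' ->] := IH _ (ltW hm2).
rewrite [h (m - w2) == _]lt_eqF // mulr0 addr0.
have -> : (h (m - w1) == B + h w1 *+ n) = (h m == B + h w1 *+ n.+1).
  by rewrite raddfB mulrS addrCA subr_eq addrC.
case: ifP => _; last by exists 0; rewrite mulr0.
rewrite mulrA -qD; eexists; congr (_ * coef w _).
by rewrite mulrS opprD addrA.
Qed.

(** Here [X] is homogeneous for [h], so multiplying by it shifts the grading. *)
Lemma restrict_mul_binomial w x : h w1 = h w2 ->
  keep (fun m => h m == x + h w1) (w * X) = keep (fun m => h m == x) w * X.
Proof.
move=> h12; apply: tcoef_inj => m; rewrite tcoef_restrict !coef_mul_binomial !tcoef_restrict.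
rewrite !raddfB -h12 subr_eq.
by case: ifP; rewrite ?mulr0 ?addr0.
Qed.

Lemma restrict_mul_binomialX w x n : h w1 = h w2 ->
  keep (fun m => h m == x + h w1 *+ n) (w * X ^+ n) =
  keep (fun m => h m == x) w * X ^+ n.
Proof.
move=> h12; elim: n => [|n IH]; first by rewrite mulr0n addr0 !mulr1.
by rewrite mulrSr addrA !exprSr !mulrA restrict_mul_binomial // IH.
Qed.

End Binomial.
End Torus.

(** * Mutation *)

Section MutationMaps.
Variables (K : comNzRingType) (q : int -> K) (Iuf If : finType).
Variables (t : seed Iuf If) (k : Iuf).
Local Notation M := (lattice Iuf If).
Local Notation fk := (f_ (inl k) : M).
Local Notation ep := (exchange_exp t k 1).
Local Notation em := (exchange_exp t k (-1)).
Variables (A A' : torus q M) (F : unitRingType).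
Variables (i_ : {rmorphism A -> F}) (j_ : {rmorphism A' -> F}).
Hypothesis q0 : q 0 = 1.
Hypothesis qD : forall e e', q (e + e') = q e * q e'.
Local Notation xpow := (tmon A).
Local Notation xpow' := (tmon A').
Local Notation coef := (@tcoef K q M A).
Local Notation coef' := (@tcoef K q M A').
Local Notation lam := (@tform K q M A).
Local Notation lam' := (@tform K q M A').
Local Notation keep := (@trestrict K q M A).
Local Notation keep' := (@trestrict K q M A').
Local Notation X := (xpow em + xpow ep).
Hypothesis F_unit : forall x : F, x != 0 -> x \is a GRing.unit.
Hypothesis i_inj : injective i_.
Hypothesis j_inj : injective j_.
Hypothesis j_scalar : forall a : K, j_ a%:A = i_ a%:A.
Hypothesis j_x : forall i, i != inl k -> j_ (xpow' (f_ i)) = i_ (xpow (f_ i)).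
Hypothesis j_xk : j_ (xpow' fk) = i_ X.

(** Membership in the intersection, as a relation between the two presentations of one element. *)
Definition cap (z : A) (z' : A') := j_ z' = i_ z.

Lemma j_scale x (z' : A') : j_ (x *: z') = i_ (x%:A) * j_ z'.
Proof. by rewrite -[z' in LHS]mul1r scalerAl !rmorphM j_scalar. Qed.

Lemma capP x (w : A) (w' : A') (z : A) (z' : A') : cap w w' -> cap z z' -> cap (x *: w + z) (x *: w' + z').
Proof.
rewrite /cap => ww' zz'.
by rewrite !rmorphD /= j_scale ww' zz' -rmorphM /= -scalerAl mul1r.
Qed.

Lemma cap0 : cap 0 0.
Proof. by rewrite /cap !rmorph0. Qed.

Lemma capB (w : A) (w' : A') (z : A) (z' : A') : cap w w' -> cap z z' -> cap (z - w) (z' - w').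
Proof.
by move=> ww' zz'; have := capP (-1) ww' zz'; rewrite !scaleN1r ![- _ + _]addrC.
Qed.

Lemma cap_sum (J : choiceType) (S : {fset J}) (a : J -> K) (z : J -> A) (z' : J -> A') :
  (forall j, cap (z j) (z' j)) ->
  cap (\sum_(j <- S) a j *: z j) (\sum_(j <- S) a j *: z' j).
Proof.
move=> zz'; elim: (enum_fset S) => [|j s IH]; first by rewrite !big_nil; apply: cap0.
by rewrite !big_cons; apply: capP.
Qed.

Lemma cap_eq0 (z : A) (z' : A') : cap z z' -> (z == 0) = (z' == 0).
Proof.
move=> zz'; apply/eqP/eqP => [z0|z0]; move: zz'; rewrite /cap z0 rmorph0.
  by rewrite -[RHS](rmorph0 j_) => /j_inj.
by rewrite -[LHS](rmorph0 i_) => /i_inj.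
Qed.

Lemma j_xpow_unit m : j_ (xpow' m) \is a GRing.unit.
Proof.
apply: F_unit; apply/eqP; rewrite -[RHS](rmorph0 j_) => /j_inj x0.
have := congr1 (fun z => coef' z m) x0; rewrite tcoef0 tcoef_mon eqxx => /eqP.
by rewrite oner_eq0.
Qed.

Lemma frac_X_unit n : i_ (X ^+ n) \is a GRing.unit.
Proof. by rewrite rmorphXn /= -j_xk unitrX // j_xpow_unit. Qed.

(** The exponents satisfying the claim form a subgroup containing each [f_i] with [i <> k], as
    mutation fixes [x_i]. *)
Lemma mut_xpow_fixed (m : M) : m (inl k) = 0 ->
  exists e, cap (q e *: xpow m) (xpow' m).
Proof.
pose R a := exists e, cap (q e *: xpow a) (xpow' a).
have R0 : R 0 by exists 0; rewrite /cap q0 scale1r !tmon0 !rmorph1.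
have RD a b : R a -> R b -> R (a + b).
  move=> [e ea] [e' eb]; rewrite /R /cap.
  rewrite [xpow' _](tmonD A' q0 qD) j_scale !rmorphM /= ea eb -!rmorphM /=.
  rewrite -!scalerAl mul1r tscalerAr tmonM !scalerA -!qD.
  by eexists; reflexivity.
have RN a : R a -> R (- a).
  move=> Ra; have [e ea] := Ra; rewrite /R /cap.
  have e1 : j_ (xpow' (- a) * xpow' a) =
      i_ (q (lam' (- a) a))%:A.
    by rewrite tmonM addNr tmon0 j_scale !rmorph1 mulr1.
  move: e1; rewrite rmorphM /= ea => e1.
  exists (lam' (- a) a - lam (- a) a - e).
  have ua : i_ (q e *: xpow a) \is a GRing.unit.
    by rewrite -ea j_xpow_unit.
  apply: (mulIr ua); rewrite e1 -rmorphM /=; congr (i_ _).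
  rewrite -scalerAl tscalerAr tmonM addNr tmon0 !scalerA -!qD.
  by congr (q _ *: _); ring.
have Rf i : i != inl k -> R (f_ i).
  by move=> ik; exists 0; rewrite /cap q0 scale1r j_x.
have RMz a n : R a -> R (a *~ n).
  move=> Ra; have RMn i : R (a *+ i) by elim: i => [//|i IH]; rewrite mulrS; apply: RD.
  by case: n => n; [exact: RMn|exact/RN/RMn].
move=> mk; rewrite -/(R m).
have -> : m = \sum_i f_ i *~ m i.
  apply/ffunP => j; rewrite sum_ffunE (bigD1 j) //= big1 => [|i ij].
    by rewrite addr0 ffunMzE ffunE eqxx intz.
  by rewrite ffunMzE ffunE eq_sym (negbTE ij) mul0rz.
elim/big_ind: _ => // i _; have [->|/Rf] := eqVneq i (inl k).
  by rewrite mk mulr0z.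
exact: RMz.
Qed.

Lemma mut_xpow_pos (m : M) n : m (inl k) = n%:Z ->
  exists e, j_ (xpow' m) = i_ (q e *: xpow (m - fk *+ n) * X ^+ n).
Proof.
move=> mk; have m0 : (m - fk *+ n) (inl k) = 0.
  by rewrite !ffunE ffunMnE ffunE mk eqxx /= natz subrr.
have [e E] := mut_xpow_fixed m0.
have [e' E'] := tmon_addMn A' q0 qD (m - fk *+ n) fk n.
rewrite subrK in E'; rewrite E' j_scale !rmorphM /= E !rmorphXn /= j_xk.
rewrite -rmorphXn -!rmorphM /= mulrA -scalerAl mul1r scalerA -qD.
by eexists; reflexivity.
Qed.

(** A negative power of [x_k'] puts a power of [X] in the denominator; moving it to the left keeps
    the right-hand side in the image of [A]. *)
Lemma mut_xpow_neg (m : M) n : m (inl k) = - n%:Z ->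
  exists e, j_ (xpow' m) * i_ (X ^+ n) = i_ (q e *: xpow (m + fk *+ n)).
Proof.
move=> mk; have m0 : (m + fk *+ n) (inl k) = 0.
  by rewrite !ffunE ffunMnE ffunE mk eqxx /= natz addNr.
have [e E] := mut_xpow_fixed m0.
have [e' E'] := tmon_addMn A' q0 qD m fk n.
move: E; rewrite /cap => E.
have {}E' : q (- e') *: xpow' (m + fk *+ n) = xpow' m * xpow' fk ^+ n.
  by rewrite E' scalerA (qNK q0 qD) scale1r.
rewrite rmorphXn /= -j_xk -!rmorphXn -!rmorphM /= -E' j_scale E -rmorphM /=.
rewrite -scalerAl mul1r scalerA -qD.
by eexists; reflexivity.
Qed.

(** * Gradings compatible with mutation *)

Section Grading.
Variable l : {additive M -> int}.
Hypothesis l_exch : l em = l ep.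

(** A monomial of [t'] times a power of [X] is homogeneous of the degree prescribed by [psi],
    because [X] is homogeneous. Linear combinations use the sum of the two exponents as common
    denominator. *)
Lemma clear_denominators x (z' : A') : exists N y,
  j_ z' * i_ (X ^+ N) = i_ y /\
  j_ (keep' (fun m => l (mono t k m) == x) z') * i_ (X ^+ N) =
    i_ (keep (fun m => l m == x + l em *+ N) y).
Proof.
elim/torus_ind: z' => [|a w z [N [y [y1 y2]]] [N' [y' [y1' y2']]]|m].
- exists 0%N, 0; rewrite !restrict0 !rmorph0.
  by rewrite mul0r.
- exists (N + N')%N, (a *: (y * X ^+ N') + y' * X ^+ N).
  rewrite !restrictP !rmorphD /= !j_scale !mulrDl.
  have E u (v : A) n1 n2 (v1 : A) : j_ u * i_ (X ^+ n1) = i_ v1 ->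
     v = v1 * X ^+ n2 -> j_ u * i_ (X ^+ (n1 + n2)) = i_ v.
    by move=> uv ->; rewrite exprD rmorphM mulrA uv -rmorphM.
  split.
    rewrite -mulrA (E _ _ _ _ _ y1 erefl) addnC (E _ _ _ _ _ y1' erefl).
    by rewrite -rmorphM /= -scalerAl mul1r.
  have K1 : keep (fun m => l m == x + l em *+ (N + N')) (y * X ^+ N') =
     keep (fun m => l m == x + l em *+ N) y * X ^+ N'.
    by rewrite mulrnDr addrA restrict_mul_binomialX.
  have K2 : keep (fun m => l m == x + l em *+ (N + N')) (y' * X ^+ N) =
     keep (fun m => l m == x + l em *+ N') y' * X ^+ N.
    by rewrite addnC mulrnDr addrA restrict_mul_binomialX.
  rewrite K2 K1 -mulrA (E _ _ _ _ _ y2 erefl) addnC (E _ _ _ _ _ y2' erefl).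
  by rewrite -rmorphM /= -scalerAl mul1r.
(* For a monomial each component is everything or zero, so homogeneity of [y] suffices. *)
have homog N y : (forall n, coef y n != 0 -> l n = l (mono t k m) + l em *+ N) ->
  j_ (xpow' m) * i_ (X ^+ N) = i_ y -> exists N y,
  j_ (xpow' m) * i_ (X ^+ N) = i_ y /\
  j_ (keep' (fun m => l (mono t k m) == x) (xpow' m)) * i_ (X ^+ N) =
    i_ (keep (fun m => l m == x + l em *+ N) y).
  move=> yh yE; exists N, y; split=> //.
  have -> : keep (fun m => l m == x + l em *+ N) y =
      if l (mono t k m) == x then y else 0.
    apply: tcoef_inj => n; rewrite tcoef_restrict.
    have [y0|/yh ->] := eqVneq (coef y n) 0.
      by rewrite y0 if_same; case: ifP; rewrite ?tcoef0 ?y0.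
    by rewrite (inj_eq (addIr _)); case: ifP; rewrite ?tcoef0.
  rewrite restrict_mon; case: ifP => _ //.
  by rewrite !rmorph0 mul0r.
have [n [mk|mk]] : exists n : nat, m (inl k) = n%:Z \/ m (inl k) = - n%:Z.
- by exists `|m (inl k)|%N; lia.
- have [e E] := mut_xpow_pos mk.
  apply: (homog 0%N); last by rewrite expr0 rmorph1 mulr1; exact: E.
  move=> m'; rewrite mulr0n addr0 /mono mk => nz.
  apply/eqP; move: nz; apply: contraNT => lm'.
  have := restrict_mul_binomialX (q e *: xpow (m - fk *+ n)) (l (m - fk *+ n)) n l_exch.
  have -> : keep (fun m0 => l m0 == l (m - fk *+ n)) (q e *: xpow (m - fk *+ n))
    = q e *: xpow (m - fk *+ n).
    apply: tcoef_inj => u; rewrite tcoef_restrict tcoefZ tcoef_mon.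
    by case: (eqVneq (m - fk *+ n) u) => [<-|_]; rewrite ?eqxx ?mulr0 ?if_same.
  move=> <-; rewrite tcoef_restrict.
  have [lm|_] := eqVneq (l m') (l (m - fk *+ n) + l em *+ n); last by rewrite eqxx.
  by move: lm'; rewrite lm -!pmulrn [X in _ != X]raddfD [X in _ != _ + X]raddfMn eqxx.
- have [e E] := mut_xpow_neg mk.
  apply: (homog n); last exact: E.
  move=> m'; rewrite tcoefZ tcoef_mon.
  have [<-|_] := eqVneq (m + fk *+ n) m'; last by rewrite mulr0 eqxx.
  move=> _; rewrite /mono mk !mulrNz opprK -!pmulrn -(raddfMn l) -raddfD.
  by rewrite subrK.
Qed.

(** Clearing denominators gives [y = z * X ^+ N], and the homogeneous unit [X ^+ N] cancels from the
    component. *)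
Lemma cap_restrict x (z : A) (z' : A') : cap z z' ->
  cap (keep (fun m => l m == x) z) (keep' (fun m => l (mono t k m) == x) z').
Proof.
rewrite /cap => zz'; have [N [y []]] := clear_denominators x z'.
rewrite zz' -rmorphM /= => /i_inj <-.
rewrite restrict_mul_binomialX // [X in _ = X]rmorphM.
exact/mulIr/frac_X_unit.
Qed.

End Grading.

(** On a single [k]-degree all monomials acquire the same power of [X], so mutation is otherwise a
    shift of exponents. *)
Lemma mut_shift_pos n (z' : A') :
  (forall m, coef' z' m != 0 -> m (inl k) = n%:Z) ->
  exists v, j_ z' = i_ (v * X ^+ n) /\
    forall m, exists e, coef v m = q e * coef' z' (m + fk *+ n).
Proof.
(* One exponent chosen per monomial makes the coefficient formula linear; stating it for the
   component of an arbitrary [w] lets the induction run. *)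
have /choice[e eE] (m : M) : exists e, m (inl k) = n%:Z ->
    j_ (xpow' m) = i_ (q e *: xpow (m - fk *+ n) * X ^+ n).
  have [/mut_xpow_pos[e eE]|mk] := eqVneq (m (inl k)) n%:Z; first by exists e.
  by exists 0 => /eqP; rewrite (negbTE mk).
suff /(_ z')[v [vE vc]] : forall w, exists v,
    j_ (keep' (fun m => m (inl k) == n%:Z) w) = i_ (v * X ^+ n) /\
    forall m, coef v m = q (e (m + fk *+ n)) *
      coef' (keep' (fun m => m (inl k) == n%:Z) w) (m + fk *+ n).
  move=> hz; have zk : keep' (fun m => m (inl k) == n%:Z) z' = z'.
    apply: tcoef_inj => m; rewrite tcoef_restrict.
    by have [->|/hz ->] := eqVneq (coef' z' m) 0; rewrite ?if_same ?eqxx.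
  rewrite zk in vE vc; exists v; split => // m.
  by exists (e (m + fk *+ n)); exact: vc.
elim/torus_ind => [|x w w' [v [vE vc]] [v' [vE' vc']]|a].
- by exists 0; rewrite restrict0 mul0r !rmorph0; split => // m; rewrite !tcoef0 mulr0.
- exists (x *: v + v'); split=> [|m].
    rewrite restrictP rmorphD /= j_scale vE vE' -rmorphM -rmorphD /=.
    by rewrite -scalerAl mul1r mulrDl scalerAl.
  rewrite restrictP !(tcoefD, tcoefZ) vc vc'; ring.
rewrite restrict_mon; case: eqP => [ak|_]; last first.
  by exists 0; rewrite mul0r !rmorph0; split => // m; rewrite !tcoef0 mulr0.
exists (q (e a) *: xpow (a - fk *+ n)); split; first exact: eE.
move=> m; rewrite tcoefZ !tcoef_mon subr_eq.
by have [->|_] := eqVneq a (m + fk *+ n); rewrite ?mulr0.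
Qed.

Lemma mut_shift_neg n (z' : A') :
  (forall m, coef' z' m != 0 -> m (inl k) = - n%:Z) ->
  exists v, j_ z' * i_ (X ^+ n) = i_ v /\
    forall m, exists e, coef v m = q e * coef' z' (m - fk *+ n).
Proof.
have /choice[e eE] (m : M) : exists e, m (inl k) = - n%:Z ->
    j_ (xpow' m) * i_ (X ^+ n) = i_ (q e *: xpow (m + fk *+ n)).
  have [/mut_xpow_neg[e eE]|mk] := eqVneq (m (inl k)) (- n%:Z); first by exists e.
  by exists 0 => /eqP; rewrite (negbTE mk).
suff /(_ z')[v [vE vc]] : forall w, exists v,
    j_ (keep' (fun m => m (inl k) == - n%:Z) w) * i_ (X ^+ n) = i_ v /\
    forall m, coef v m = q (e (m - fk *+ n)) *
      coef' (keep' (fun m => m (inl k) == - n%:Z) w) (m - fk *+ n).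
  move=> hz; have zk : keep' (fun m => m (inl k) == - n%:Z) z' = z'.
    apply: tcoef_inj => m; rewrite tcoef_restrict.
    by have [->|/hz ->] := eqVneq (coef' z' m) 0; rewrite ?if_same ?eqxx.
  rewrite zk in vE vc; exists v; split => // m.
  by exists (e (m - fk *+ n)); exact: vc.
elim/torus_ind => [|x w w' [v [vE vc]] [v' [vE' vc']]|a].
- by exists 0; rewrite restrict0 !rmorph0 mul0r; split => // m; rewrite !tcoef0 mulr0.
- exists (x *: v + v'); split=> [|m].
    rewrite restrictP rmorphD /= j_scale mulrDl -mulrA vE vE' -rmorphM -rmorphD /=.
    by rewrite -scalerAl mul1r.
  rewrite restrictP !(tcoefD, tcoefZ) vc vc'; ring.
rewrite restrict_mon; case: eqP => [ak|_]; last first.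
  by exists 0; rewrite !rmorph0 mul0r; split => // m; rewrite !tcoef0 mulr0.
exists (q (e a) *: xpow (a + fk *+ n)); split; first exact: eE.
move=> m; rewrite tcoefZ !tcoef_mon eq_sym -subr_eq eq_sym.
by have [->|_] := eqVneq a (m - fk *+ n); rewrite ?mulr0.
Qed.

End MutationMaps.

(** * Leading terms and level-wise comparison *)

Section LeadingTerms.
Variables (K : comNzRingType) (q : int -> K) (Iuf If : finType).
Variables (c : setting) (d : Iuf + If -> nat) (t : seed Iuf If) (k : Iuf).
Local Notation t' := (mutate k t).
Local Notation M := (lattice Iuf If).
Local Notation fk := (f_ (inl k) : M).
Local Notation ep := (exchange_exp t k 1).
Local Notation em := (exchange_exp t k (-1)).
Local Notation phi := (tropical t k).
Local Notation psi := (mono t k).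
Variables (A A' : torus q M) (F : unitRingType).
Variables (i_ : {rmorphism A -> F}) (j_ : {rmorphism A' -> F}).
Hypothesis q0 : q 0 = 1.
Hypothesis qD : forall e e', q (e + e') = q e * q e'.
Local Notation xpow := (tmon A).
Local Notation xpow' := (tmon A').
Local Notation coef := (@tcoef K q M A).
Local Notation coef' := (@tcoef K q M A').
Local Notation keep := (@trestrict K q M A).
Local Notation keep' := (@trestrict K q M A').
Local Notation X := (xpow em + xpow ep).
Hypothesis F_unit : forall x : F, x != 0 -> x \is a GRing.unit.
Hypothesis i_inj : injective i_.
Hypothesis j_inj : injective j_.
Hypothesis j_scalar : forall a : K, j_ a%:A = i_ a%:A.
Hypothesis j_x : forall i, i != inl k -> j_ (xpow' (f_ i)) = i_ (xpow (f_ i)).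
Hypothesis j_xk : j_ (xpow' fk) = i_ X.
Local Notation cap := (cap i_ j_).

Hypothesis d_gt0 : forall i, (0 < d i)%N.
Hypothesis t_seed : is_seed c d t.
Variables l r r' : {additive M -> int}.
Hypothesis lk : l (bcol t k) = 0.
Hypothesis l_gt0 : forall i, i != k -> 0 < l (bcol t i).
Hypothesis r_gt0 : forall i, 0 < r (bcol t i).
Hypothesis r'_gt0 : forall i, 0 < r' (bcol t' i).

Variables (s : M -> A) (s' : M -> A').
Hypothesis s_cap : forall g, cap (s g) (s' g).
Hypothesis s1 : forall g, coef (s g) g = 1.
Hypothesis s1' : forall g, coef' (s' g) (phi g) = 1.
Hypothesis s_dom : forall g m, coef (s g) m != 0 -> dominated t m g.
Hypothesis s_dom' : forall g m, coef' (s' g) m != 0 -> dominated t' m (phi g).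

Lemma s_level g m : coef (s g) m != 0 -> l g <= l m.
Proof.
move=> /s_dom/dominated_le; apply=> i.
by have [->|/l_gt0/ltW//] := eqVneq i k; rewrite lk.
Qed.

Lemma lmono_k : l (psi (bcol t' k)) = 0.
Proof. by rewrite (mono_bcol_k k d_gt0 t_seed) raddfN /= lk oppr0. Qed.

Lemma lmono_gt0 i : i != k -> 0 < l (psi (bcol t' i)).
Proof.
move=> ik; rewrite (mono_bcol d_gt0 t_seed) // raddfD raddfMz /= lk mul0rz addr0.
exact: l_gt0.
Qed.

Lemma s_level' g m : coef' (s' g) m != 0 -> l g <= l (psi m).
Proof.
move=> /s_dom'/(@dominated_le _ _ _ (l \o psi)) /=.
rewrite (level_tropical d_gt0 t_seed _ lk); apply=> i.
by have [->|/lmono_gt0/ltW//] := eqVneq i k; rewrite lmono_k.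
Qed.

Lemma s_string g m : coef (s g) m != 0 -> l m = l g ->
  exists n, m = g + bcol t k *+ n.
Proof. by move=> /s_dom md; apply: dominated_level md. Qed.

(** The sign comes from [p'_k = - p_k]: strings of the two seeds run in opposite directions. *)
Lemma s_string' g m : coef' (s' g) m != 0 -> l (psi m) = l g ->
  exists n, m = phi g - bcol t k *+ n.
Proof.
move=> /s_dom' md lm.
have lm' : (l \o psi) m = (l \o psi) (phi g).
  by rewrite /= lm (level_tropical d_gt0 t_seed _ lk).
have [n ->] := dominated_level (w := l \o psi) lmono_k lmono_gt0 md lm'.
exists n; rewrite -mulNrn; congr (_ + _ *+ _).
by apply/ffunP => i; rewrite !ffunE (bint_mutate_k k t_seed).
Qed.

Lemma bcol_sum0 a b : bcol t k *+ (a + b) = 0 -> a = 0%N /\ b = 0%N.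
Proof.
move=> /(congr1 r)/eqP; rewrite raddfMn raddf0 mulrn_eq0 (gt_eqF (r_gt0 k)) orbF.
by rewrite addn_eq0 => /andP[/eqP-> /eqP->].
Qed.

Lemma string_inl_k (g : M) n : (g + bcol t k *+ n) (inl k) = g (inl k).
Proof. by rewrite !ffunE ffunMnE (bcol_diag k d_gt0 t_seed) mul0rn addr0. Qed.

Lemma string_inl_k' (g : M) n : (phi g - bcol t k *+ n) (inl k) = - g (inl k).
Proof.
rewrite !ffunE eqxx ffunMnE (bcol_diag k d_gt0 t_seed).
by rewrite mul0rn subr0.
Qed.

Lemma exchange_level : l em = l ep.
Proof. by rewrite exchange_exp1 [RHS]raddfD lk addr0. Qed.

(** Lowest levels of [s g] and [s' g]; the same value [l g] works for both because
    [l (psi (phi g)) = l g]. *)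
Let u g := keep (fun m => l m == l g) (s g).
Let u' g := keep' (fun m => l (psi m) == l g) (s' g).

Lemma u_cap g : cap (u g) (u' g).
Proof. exact: (cap_restrict q0 qD F_unit i_inj j_inj j_scalar j_x j_xk exchange_level). Qed.

Lemma u_string g m : coef (u g) m != 0 -> exists n, m = g + bcol t k *+ n.
Proof.
rewrite tcoef_restrict; case: ifP => [/eqP lm sm|_]; last by rewrite eqxx.
exact: s_string.
Qed.

Lemma u_string' g m : coef' (u' g) m != 0 -> exists n, m = phi g - bcol t k *+ n.
Proof.
rewrite tcoef_restrict; case: ifP => [/eqP lm sm|_]; last by rewrite eqxx.
exact: s_string'.
Qed.

(** [u g * X ^+ n] is a shift of [u' g]. The far end [m1] of the string of [u g] yields the extremal
    degree [m1 + ep *+ n], which must match some [phi g - a p_k]. Hence [m1 = g - a p_k], while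
    [m1 = g + b p_k], so [a = b = 0] and the string reduces to [g]. *)
Lemma leading_pos (g m : M) : 0 <= g (inl k) -> coef (s g) m != 0 -> l m = l g -> m = g.
Proof.
move=> gk sm lm; set n := `|g (inl k)|%N.
have gn : g (inl k) = n%:Z by rewrite /n; lia.
have um : coef (u g) m != 0 by rewrite tcoef_restrict lm eqxx.
have u'k m' : coef' (u' g) m' != 0 -> m' (inl k) = - n%:Z.
  by move=> /u_string'[a ->]; rewrite string_inl_k' gn.
have [v [vE vc]] := mut_shift_neg q0 qD F_unit j_inj j_scalar j_x j_xk u'k.
move: vE; rewrite u_cap -rmorphM => /i_inj vE.
(* For [- r] the lowest term is the far end of the string, and [ep] is the lower exponent of [X]. *)
have [m1 um1 m1min] := lowest_term (-%R \o r) um.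
have low m' : (-%R \o r) m' < - r m1 -> coef (u g) m' = 0.
  by move=> lt; apply/eqP; apply: contraTT lt => /m1min; rewrite -leNgt.
have hlt : (-%R \o r) ep < (-%R \o r) em.
  by rewrite /= exchange_exp1 ltrN2 [ltRHS]raddfD ltrDl r_gt0.
have [] := coef_mul_binomial_lowest q0 qD hlt low (m := m1 + ep *+ n) (n := n).
  by rewrite /= raddfD raddfMn opprD mulNrn.
move=> e; rewrite [X in X == _]/= raddfD raddfMn opprD mulNrn eqxx addrK.
rewrite [xpow ep + _]addrC vE => vne.
have [e' ve'] := vc (m1 + ep *+ n).
have : coef' (u' g) (m1 + ep *+ n - fk *+ n) != 0.
  by rewrite -(q_eq0 q0 qD e') -ve' vne (q_eq0 q0 qD).
move=> /u_string'[a ma]; have [b mb] := u_string um1.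
have ab : bcol t k *+ (a + b) = 0.
  move: ma; rewrite (tropical_pos d_gt0 t_seed) // gn -!pmulrn mb.
  rewrite mulrnDr; move: (_ *+ a) (_ *+ b) (ep *+ n) (fk *+ n) => P Q y x E.
  apply/ffunP => j; move/ffunP: E => /(_ j); rewrite !ffunE.
  by move: (g j : int) (Q j : int) (x j : int) (y j : int) (P j : int) => *; lia.
have [_ b0] := bcol_sum0 ab; rewrite b0 mulr0n addr0 in mb.
have [b' mb'] := u_string um; move: (m1min _ um); rewrite mb mb' /= lerN2.
rewrite raddfD raddfMn gerDl; case: b' {mb'} => [|b']; first by rewrite mulr0n addr0.
by rewrite pmulrn_lle0 // leNgt r_gt0.
Qed.

(** Dually, [u g = v * X ^+ n] with [v] a shift of [u' g]; the string of [u' g] runs along [- p_k],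
    so its far end has least [r]. *)
Lemma leading_neg (g m : M) : g (inl k) <= 0 -> coef' (s' g) m != 0 -> l (psi m) = l g ->
  m = phi g.
Proof.
move=> gk sm lm; set n := `|g (inl k)|%N.
have gn : g (inl k) = - n%:Z by rewrite /n; lia.
have um : coef' (u' g) m != 0 by rewrite tcoef_restrict lm eqxx.
have u'k m' : coef' (u' g) m' != 0 -> m' (inl k) = n%:Z.
  by move=> /u_string'[a ->]; rewrite string_inl_k' gn opprK.
have [v [vE vc]] := mut_shift_pos q0 qD F_unit j_inj j_scalar j_x j_xk u'k.
move: vE; rewrite u_cap => /i_inj vE.
have [m1 um1 m1min] := lowest_term r um.
have low m' : r m' < r (m1 - fk *+ n) -> coef v m' = 0.
  move=> lt; have [e ->] := vc m'; apply/eqP; rewrite (q_eq0 q0 qD).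
  apply: contraTT lt => /m1min; rewrite -leNgt raddfB lerBlDr.
  by rewrite raddfD.
have hlt : r em < r ep by rewrite exchange_exp1 [ltRHS]raddfD ltrDl r_gt0.
have [] := coef_mul_binomial_lowest q0 qD hlt low (m := m1 - fk *+ n + em *+ n) (n := n).
  by rewrite [leLHS]raddfD [r (em *+ n)]raddfMn.
move=> e; rewrite [r (_ + em *+ n)]raddfD [r (em *+ n)]raddfMn eqxx addrK -vE => une.
have [e' ve'] := vc (m1 - fk *+ n); rewrite subrK in ve'.
have : coef (u g) (m1 - fk *+ n + em *+ n) != 0.
  by rewrite une (q_eq0 q0 qD) ve' (q_eq0 q0 qD).
move=> /u_string[b mb]; have [a ma] := u_string' um1.
have ab : bcol t k *+ (a + b) = 0.
  move: mb; rewrite ma (tropical_neg d_gt0 t_seed) // gn !mulrNz -!pmulrn.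
  rewrite mulrnDr; move: (_ *+ a) (_ *+ b) (em *+ n) (fk *+ n) => P Q y x E.
  apply/ffunP => j; move/ffunP: E => /(_ j); rewrite !ffunE.
  by move: (g j : int) (Q j : int) (x j : int) (y j : int) (P j : int) => *; lia.
have [a0 _] := bcol_sum0 ab; rewrite a0 mulr0n subr0 in ma.
have [b' mb'] := u_string' um; move: (m1min _ um); rewrite ma mb'.
rewrite raddfB raddfMn lerBrDr gerDl; case: b' {mb'} => [|b'].
  by rewrite mulr0n subr0.
by rewrite pmulrn_lle0 // leNgt r_gt0.
Qed.

Local Notation S_ := (fun g m => coef (s g) m).
Local Notation S'_ := (fun g m => coef' (s' g) m).

Lemma expansion_unique_t b z L B : expands S_ b (coef z) ->
  (forall g, b g != 0 -> L <= l g) -> (forall g, b g != 0 -> B <= r g) ->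
  (forall m, l m = L -> coef z m = 0) -> forall g, l g = L -> b g = 0.
Proof.
move=> ez bL bB z0; apply: (expansion_unique (deg := id) s1 _ ez bL bB z0) => i j ij sij.
split; first exact: s_level.
rewrite ltNge; apply: contra ij => rij.
by rewrite (dominated_eq r_gt0 (s_dom sij) rij).
Qed.

(** Coefficients stay indexed by [g]; only degree and rank pass through [phi], so both seeds share
    an index set. *)
Lemma expansion_unique_t' b z L B : expands S'_ b (coef' z) ->
  (forall g, b g != 0 -> L <= l g) -> (forall g, b g != 0 -> B <= r' (phi g)) ->
  (forall m, l (psi m) = L -> coef' z m = 0) -> forall g, l g = L -> b g = 0.
Proof.
have lphi g : l (psi (phi g)) = l g by rewrite (level_tropical d_gt0 t_seed _ lk).
move=> ez bL bB z0.
apply: (expansion_unique (deg := phi) (rk := r' \o phi) s1' _ ez bL bB) => [i j ij sij|j jL].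
  split; first by rewrite -[l j]lphi s_level'.
  rewrite ltNge; apply: contra ij => rij.
  have /(can_inj (tropicalK t k)) -> // := dominated_eq r'_gt0 (s_dom' sij) rij.
by apply: z0; rewrite lphi.
Qed.

(** * Coefficients on the lowest level of an expansion *)

Section LowestLevel.
Variables (b b' : M -> K) (z : A) (z' : A') (L : int).
Hypothesis zz' : cap z z'.
Hypothesis ez : expands S_ b (coef z).
Hypothesis ez' : expands S'_ b' (coef' z').
Hypothesis bL : forall g, b g != 0 -> L <= l g.
Hypothesis bL' : forall g, b' g != 0 -> L <= l g.

(** No index lies below [L], and indices above [L] cannot reach it. Along a string the [k]-degree is
    constant because [p_k] has zero [k]-th coordinate. *)
Lemma support_string i m : l m = L -> b i * coef (s i) m != 0 ->
  [/\ l i = L, coef (s i) m != 0 & m (inl k) = i (inl k)].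
Proof.
move=> mL bs; have bi : b i != 0 by apply: contra_neq bs => ->; rewrite mul0r.
have si : coef (s i) m != 0 by apply: contra_neq bs => ->; rewrite mulr0.
have il : l i = L by apply/eqP; rewrite eq_le -{1}mL s_level // bL.
split=> //; have [n ->] : exists n, m = i + bcol t k *+ n.
  by apply: s_string; rewrite // il.
exact: string_inl_k.
Qed.

Lemma support_string' i m : l (psi m) = L -> b' i * coef' (s' i) m != 0 ->
  [/\ l i = L, coef' (s' i) m != 0 & m (inl k) = - i (inl k)].
Proof.
move=> mL bs; have bi : b' i != 0 by apply: contra_neq bs => ->; rewrite mul0r.
have si : coef' (s' i) m != 0 by apply: contra_neq bs => ->; rewrite mulr0.
have il : l i = L by apply/eqP; rewrite eq_le -{1}mL s_level' // bL'.
split=> //; have [n ->] : exists n, m = phi i - bcol t k *+ n.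
  by apply: s_string'; rewrite // il.
exact: string_inl_k'.
Qed.

(** An index contributing at [g] has the same nonnegative [k]-degree, so its lowest level is a
    single monomial and the index is [g]. *)
Lemma coef_pos (g : M) : l g = L -> 0 <= g (inl k) -> coef z g = b g.
Proof.
move=> gL gk; rewrite (expands_single (j := g) ez) ?s1 ?mulr1 // => i ig.
apply/eqP; apply: contraNT ig => /(support_string gL)[iL si gi].
by rewrite (leading_pos (g := i) (m := g)) ?gL // -gi.
Qed.

Lemma coef_neg (g : M) : l g = L -> g (inl k) <= 0 -> coef' z' (phi g) = b' g.
Proof.
have lphi h : l (psi (phi h)) = l h by rewrite (level_tropical d_gt0 t_seed _ lk).
move=> gL gk; rewrite (expands_single (j := g) ez') ?s1' ?mulr1 // => i ig.
have gL' : l (psi (phi g)) = L by rewrite lphi.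
apply/eqP; apply: contraNT ig => /(support_string' gL')[iL si].
rewrite tropical_inl_k => /oppr_inj gi.
have /(can_inj (tropicalK t k)) -> // : phi g = phi i.
by apply: leading_neg; rewrite -?gi // gL'.
Qed.

Lemma coef_pos_eq0 (m : M) : l m = L -> 0 <= m (inl k) ->
  (forall g, l g = L -> 0 <= g (inl k) -> b g = 0) -> coef z m = 0.
Proof.
move=> mL mk b0; apply: (expands_zero ez) => i; apply/eqP; apply: contraT.
by move=> bs; have [iL _ mi] := support_string mL bs; rewrite b0 -?mi // mul0r eqxx in bs.
Qed.

Lemma coef_neg_eq0 (m : M) : l (psi m) = L -> 0 < m (inl k) ->
  (forall g, l g = L -> g (inl k) < 0 -> b' g = 0) -> coef' z' m = 0.
Proof.
move=> mL mk b0; apply: (expands_zero ez') => i; apply/eqP; apply: contraT.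
move=> bs; have [iL _ mi] := support_string' mL bs.
by rewrite b0 -?oppr_gt0 -?mi // mul0r eqxx in bs.
Qed.

(* Graded by the k-degree, [z] and [z'] correspond degree by degree, and in each
   degree one of the two hypotheses makes the component vanish. *)
Lemma cap_level_eq0 :
  (forall m : M, l m = L -> 0 <= m (inl k) -> coef z m = 0) ->
  (forall m : M, l (psi m) = L -> 0 < m (inl k) -> coef' z' m = 0) ->
  (forall m, l m = L -> coef z m = 0) /\ (forall m, l (psi m) = L -> coef' z' m = 0).
Proof.
move=> z0 z0'; set y := keep (fun m => l m == L) z.
set y' := keep' (fun m => l (psi m) == L) z'.
have yy' : cap y y'.
  exact: (cap_restrict q0 qD F_unit i_inj j_inj j_scalar j_x j_xk exchange_level).
have ck : kdeg k em = kdeg k ep.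
  by rewrite /kdeg exchange_exp1 [RHS]ffunE (bcol_diag k d_gt0 t_seed) addr0.
have comp x := cap_restrict q0 qD F_unit i_inj j_inj j_scalar j_x j_xk ck x yy'.
have comp0 x : keep (fun m => kdeg k m == x) y = 0 /\
    keep' (fun m => kdeg k (psi m) == x) y' = 0.
  have [x0|x0] := leP 0 x.
    have e : keep (fun m => kdeg k m == x) y = 0.
      apply: tcoef_inj => m; rewrite !tcoef_restrict tcoef0.
      by case: eqP => // mx; case: eqP => // mL; apply: z0; rewrite // -[m _]/(kdeg k m) mx.
    by split=> //; have := cap_eq0 i_inj j_inj (comp x); rewrite e eqxx => /esym/eqP.
  have e : keep' (fun m => kdeg k (psi m) == x) y' = 0.
    apply: tcoef_inj => m; rewrite !tcoef_restrict tcoef0.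
    case: eqP => // mx; case: eqP => // mL; apply: z0' => //.
    by move: mx x0; rewrite /kdeg (mono_inl_k k d_gt0 t_seed) => <-; rewrite oppr_lt0.
  by split=> //; have := cap_eq0 i_inj j_inj (comp x); rewrite e eqxx => /eqP.
split=> m mL.
  have [/(congr1 (fun w => coef w m)) + _] := comp0 (kdeg k m).
  by rewrite !tcoef_restrict tcoef0 eqxx mL eqxx.
have [_ /(congr1 (fun w => coef' w m))] := comp0 (kdeg k (psi m)).
by rewrite !tcoef_restrict tcoef0 eqxx mL eqxx.
Qed.

End LowestLevel.

(** Both coefficient functions are compared with one candidate [e]. Removing the finite sum of the
    [e g *: s g] empties the level, and uniqueness in each seed then gives [b = e = b'] there. *)
Lemma lowest_level_eq (b b' : M -> K) (z : A) (z' : A') (L B B' : int) :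
  cap z z' -> expands S_ b (coef z) -> expands S'_ b' (coef' z') ->
  (forall g, b g != 0 -> L <= l g) -> (forall g, b' g != 0 -> L <= l g) ->
  (forall g, b g != 0 -> B <= r g) -> (forall g, b' g != 0 -> B' <= r' (phi g)) ->
  exists S : {fset M}, (forall g, g \in S -> l g = L) /\
    forall g, l g = L -> b g = b' g /\ (g \notin S -> b g = 0).
Proof.
move=> zz' ez ez' bL bL' bB bB'.
(* Each half-space uses the seed in which the lowest level of [s g] is a monomial. *)
pose e (g : M) := if 0 <= g (inl k) then coef z g else coef' z' (phi g).
have [T zT] := tcoef_fin z; have [T' zT'] := tcoef_fin z'.
pose S := [fset g in T `|` [fset tropical_inv t k m | m in T'] | l g == L]%fset.
have SL g : g \in S -> l g = L by rewrite !inE => /andP[_ /eqP].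
have eS g : l g = L -> g \notin S -> e g = 0.
  move=> gL; apply: contraNeq; rewrite /e !inE /= gL eqxx andbT.
  case: ifP => _; first by move/zT ->.
  move=> /zT' gT'; apply/orP; right.
  by apply/imfsetP; exists (phi g); rewrite ?tropicalK.
pose e0 g := if g \in S then e g else 0.
have e0E g : l g = L -> e0 g = e g.
  by move=> gL; rewrite /e0; case: ifPn => // /(eS _ gL).
have e0L g : e0 g != 0 -> l g = L.
  by rewrite /e0; case: ifP => [/SL//|]; rewrite eqxx.
pose y := z - \sum_(g <- S) e g *: s g; pose y' := z' - \sum_(g <- S) e g *: s' g.
have yy' : cap y y' by apply: capB => //; apply: cap_sum.
have ey : expands S_ (fun g => b g - e0 g) (coef y).
  have := expandsB ez (expands_finite S_ S e).
  congr expands; apply/funext => m; rewrite tcoefB tcoef_sum; congr (_ - _).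
  by apply: eq_bigr => g _; rewrite tcoefZ.
have ey' : expands S'_ (fun g => b' g - e0 g) (coef' y').
  have := expandsB ez' (expands_finite S'_ S e).
  congr expands; apply/funext => m; rewrite tcoefB tcoef_sum; congr (_ - _).
  by apply: eq_bigr => g _; rewrite tcoefZ.
have yL g : b g - e0 g != 0 -> L <= l g.
  have [/e0L ->//|] := boolP (e0 g != 0); rewrite negbK => /eqP ->.
  by rewrite subr0 => /bL.
have yL' g : b' g - e0 g != 0 -> L <= l g.
  have [/e0L ->//|] := boolP (e0 g != 0); rewrite negbK => /eqP ->.
  by rewrite subr0 => /bL'.
(* Subtraction may enlarge the supports by elements of [S]; [C] bounds their ranks from below. *)
pose C := - \sum_(g <- S) (`|r g| + `|r' (phi g)|).
have CP g : e0 g != 0 -> C <= r g /\ C <= r' (phi g).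
  rewrite /e0 /C; case: ifP => [gS _|]; last by rewrite eqxx.
  rewrite (big_fsetD1 g) //=; set u0 := \sum_(_ <- _) _.
  have u00 : 0 <= u0 by apply: sumr_ge0 => h _; rewrite addr_ge0.
  by lia.
have yB g : b g - e0 g != 0 -> Num.min B C <= r g.
  have [/CP[? _] _|] := boolP (e0 g != 0); first by lia.
  by rewrite negbK => /eqP ->; rewrite subr0 => /bB; lia.
have yB' g : b' g - e0 g != 0 -> Num.min B' C <= r' (phi g).
  have [/CP[_ ?] _|] := boolP (e0 g != 0); first by lia.
  by rewrite negbK => /eqP ->; rewrite subr0 => /bB'; lia.
have [y0 y0'] : (forall m, l m = L -> coef y m = 0) /\
    (forall m, l (psi m) = L -> coef' y' m = 0).
  (* By the choice of [e], the new coefficients vanish for [g_k >= 0] in [t] and for [g_k < 0] in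
     [t']. *)
  apply: (cap_level_eq0 yy') => m mL mk.
    apply: (coef_pos_eq0 ey yL mL mk) => g gL gk.
    by rewrite e0E // /e gk (coef_pos ez bL) // subrr.
  apply: (coef_neg_eq0 ey' yL' mL mk) => g gL gk.
  by rewrite e0E // /e leNgt gk /= (coef_neg ez' bL') ?subrr // ltW.
have b0 := expansion_unique_t ey yL yB y0.
have b0' := expansion_unique_t' ey' yL' yB' y0'.
exists S; split=> // g gL.
have /eqP := b0 g gL; rewrite subr_eq0 => /eqP bg.
have /eqP := b0' g gL; rewrite subr_eq0 => /eqP bg'.
by split=> [|gS]; rewrite bg ?bg' // e0E // eS.
Qed.

(** Induction on the number of levels. Agreement with finite support on level [L] lets the same
    finite combination be removed from [z] and [z']; as [l] is integral, what remains starts at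
    [L + 1]. *)
Lemma expansions_eq n (b b' : M -> K) (z : A) (z' : A') (L B B' : int) :
  cap z z' -> expands S_ b (coef z) -> expands S'_ b' (coef' z') ->
  (forall g, b g != 0 -> L <= l g) -> (forall g, b' g != 0 -> L <= l g) ->
  (forall g, b g != 0 -> B <= r g) -> (forall g, b' g != 0 -> B' <= r' (phi g)) ->
  forall g, l g < L + n%:Z -> b g = b' g.
Proof.
elim: n b b' z z' L => [|n IH] b b' z z' L zz' ez ez' bL bL' bB bB' g gn.
  have [->|/bL] := eqVneq (b g) 0; last by lia.
  by have [->//|/bL'] := eqVneq (b' g) 0; last by lia.
have [S [SL SE]] := lowest_level_eq zz' ez ez' bL bL' bB bB'.
have [/SE[]//|gL] := eqVneq (l g) L.
pose b0 h := if h \in S then b h else 0.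
have bb0 h : h \in S -> b' h = b h by move=> /SL/SE[].
have gS : g \notin S by apply: contra gL => /SL/eqP.
have e0 : expands S_ (fun h => b h - b0 h) (coef (z - \sum_(h <- S) b h *: s h)).
  have := expandsB ez (expands_finite S_ S b).
  congr expands; apply/funext => m; rewrite tcoefB tcoef_sum; congr (_ - _).
  by apply: eq_bigr => h _; rewrite tcoefZ.
have e0' : expands S'_ (fun h => b' h - b0 h) (coef' (z' - \sum_(h <- S) b h *: s' h)).
  have := expandsB ez' (expands_finite S'_ S b).
  congr expands; apply/funext => m; rewrite tcoefB tcoef_sum; congr (_ - _).
  by apply: eq_bigr => h _; rewrite tcoefZ.
have bS h : b h - b0 h != 0 -> b h != 0 /\ h \notin S.
  by rewrite /b0; case: ifP => _; rewrite ?subrr ?eqxx ?subr0.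
have bS' h : b' h - b0 h != 0 -> b' h != 0 /\ h \notin S.
  by rewrite /b0; case: ifP => [/bb0->|_]; rewrite ?subrr ?eqxx ?subr0.
have := IH _ _ _ _ (L + 1) _ e0 e0' _ _ _ _ g _.
rewrite /b0 (negbTE gS) !subr0; apply; last by lia.
- by apply: capB => //; apply: cap_sum.
- move=> h /bS[bh hS]; have := bL _ bh; rewrite le_eqVlt => /orP[/eqP hL|]; last by lia.
  by have [_ /(_ hS) b00] := SE h (esym hL); rewrite b00 eqxx in bh.
- move=> h /bS'[bh hS]; have := bL' _ bh; rewrite le_eqVlt => /orP[/eqP hL|]; last by lia.
  by have [bb' /(_ hS) b00] := SE h (esym hL); rewrite -bb' b00 eqxx in bh.
- by move=> h /bS[/bB].
- by move=> h /bS'[/bB'].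
Qed.

End LeadingTerms.

(** * Laurent polynomial rings as quantum tori *)

Section LaurentTorus.
Variables (c : setting) (Iuf If : finType) (t : seed Iuf If).
Local Notation M := (lattice Iuf If).
Implicit Types (a m : M).

Definition LP_restrict (P : pred M) : LP c t -> LP c t :=
  lin_ext (fun m => if P m then xpow c t m else 0).

Lemma coef_xpow a m : coef (xpow c t a) m = (a == m)%:R.
Proof. by rewrite /coef mcoeffU. Qed.

Lemma coef0 m : coef (0 : LP c t) m = 0.
Proof. exact: mcoeff0. Qed.

Lemma coefD (y z : LP c t) m : coef (y + z) m = coef y m + coef z m.
Proof. exact: mcoeffD. Qed.

Lemma coefZ x (z : LP c t) m : coef (x *: z) m = x * coef z m.
Proof. exact: mcoeffZ. Qed.

Lemma LP_ind (P : LP c t -> Prop) : P 0 ->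
  (forall x w z, P w -> P z -> P (x *: w + z)) -> (forall a, P (xpow c t a)) ->
  forall z, P z.
Proof. exact: tw_ind. Qed.

Lemma LP_scalerAr x (w z : LP c t) : w * (x *: z) = x *: (w * z).
Proof. exact: tw_mulZr. Qed.

Lemma LP_restrictP (P : pred M) x (w z : LP c t) :
  LP_restrict P (x *: w + z) = x *: LP_restrict P w + LP_restrict P z.
Proof. exact: linearP. Qed.

Lemma coef_LP_restrict P z m : coef (LP_restrict P z) m = if P m then coef z m else 0.
Proof.
elim/LP_ind: z => [|x w z IHw IHz|a].
- by rewrite [LP_restrict P _]linear0 coef0 if_same.
- by rewrite LP_restrictP !(coefD, coefZ) IHw IHz; case: ifP; rewrite ?mulr0 ?addr0.
rewrite [LP_restrict P _]lin_extU scale1r coef_xpow.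
case: eqVneq => [<-|/negbTE am]; first by case: ifP; rewrite ?coef_xpow ?coef0 ?eqxx.
by rewrite if_same; case: ifP; rewrite ?coef_xpow ?coef0 ?am.
Qed.

Lemma coef_fin (z : LP c t) : exists S : {fset M}, forall m, coef z m != 0 -> m \in S.
Proof. by exists (msupp (z : {malg (scalars c)[M]})) => m; rewrite mcoeff_neq0. Qed.

Lemma coef_inj (y z : LP c t) : (forall m, coef y m = coef z m) -> y = z.
Proof. by move=> yz; apply/malgP. Qed.

Definition LP_torus : torus (q_half c) M :=
  @Torus _ _ _ (LP c t) (lform (lam t)) (xpow c t) (@coef Iuf If c t) LP_restrict
    coef0 coefD coefZ coef_xpow coef_LP_restrict coef_fin coef_inj LP_ind
    LP_scalerAr erefl (@xpowM _ _ c t).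

End LaurentTorus.

Theorem proposition4p2p1 (c : setting) (Iuf If : finType)
  (d : Iuf + If -> nat) (d_gt0 : forall i, (0 < d i)%N)
  (t : seed Iuf If) (t_seed : is_seed c d t) (t_full : full_rank t)
  (k : Iuf)
  (F : skew_fractions (LP c t)) (F' : skew_fractions (LP c (mutate k t)))
  (mu : mutation_iso F F')
  (z : LP_cap mu) (s : lattice Iuf If -> LP_cap mu)
  (s_pointed : forall g, pointed (LP_series (in_LP (s g))) g)
  (s_pointed' : forall g, pointed (LP_series (in_LP' (s g))) (tropical t k g))
  (alpha alpha' : lattice Iuf If -> scalars c)
  (alphaE : dominance_decomposition id
     (fun g => LP_series (in_LP (s g))) (LP_series (in_LP z)) alpha)
  (alphaE' : dominance_decomposition (tropical t k)
     (fun g => LP_series (in_LP' (s g))) (LP_series (in_LP' z)) alpha') :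
  (forall g, alpha g = alpha' (tropical t k g)) /\
  tropical t k @` supp alpha = supp alpha'.
Proof.
suff main g : alpha g = alpha' (tropical t k g).
  split=> //; apply/seteqP; split=> [_ [g + <-]|g]; first by rewrite /supp /= main.
  exists (tropical_inv t k g); last exact: tropical_invK.
  by rewrite /supp /= main tropical_invK.
have [l [r [r' [lk l_gt0 r_gt0 r'_gt0]]]] := level_functionals k d_gt0 t_seed t_full.
(* Makes [l \o psi] bounded below on the support of [alpha'], as [l] is on that of [alpha]. *)
have lpsi i : 0 <= (l \o mono t k) (bcol (mutate k t) i).
  have [->|ik] := eqVneq i k.
    by rewrite /= (mono_bcol_k k d_gt0 t_seed) raddfN /= lk oppr0.
  by rewrite /= (mono_bcol d_gt0 t_seed) // raddfD raddfMz /= lk mul0rz addr0 ltW ?l_gt0.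
have l_ge0 i : 0 <= l (bcol t i).
  by have [->|/l_gt0/ltW//] := eqVneq i k; rewrite lk.
have [L1 L1P] := decomposition_bounded l_ge0 alphaE.
have [L2 L2P] := decomposition_bounded lpsi alphaE'.
have [B BP] := decomposition_bounded (fun i => ltW (r_gt0 i)) alphaE.
have [B' BP'] := decomposition_bounded (fun i => ltW (r'_gt0 i)) alphaE'.
(* The induction on levels needs a common starting level for both expansions. *)
pose L := Num.min L1 L2.
have ez := decomposition_expands alphaE.
have ez' := decomposition_expands alphaE'.
pose jj : {rmorphism LP c (mutate k t) -> F} := mu \o frac_in F'.
have jinj : injective jj.
  by apply: inj_comp; [exact: bij_inj (mut_bij mu)|exact: frac_inj].
apply: (@expansions_eq _ (q_half c) Iuf If c d t k (LP_torus c t)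
  (LP_torus c (mutate k t)) F (frac_in F) jj (q_half0 c) (@q_halfD c)
  (@frac_unit _ F) (@frac_inj _ F) jinj (mut_scalar mu) (mut_x mu) (mut_xk mu)
  d_gt0 t_seed l r r' lk l_gt0 r_gt0 r'_gt0
  (fun g => in_LP (s g)) (fun g => in_LP' (s g)) _ _ _ _ _ (absz (l g - L + 1)%R)
  alpha (alpha' \o tropical t k) (in_LP z) (in_LP' z) L B B' _ ez ez').
- by move=> h; exact: LP_capE.
- by move=> h; have [] := s_pointed h.
- by move=> h; have [] := s_pointed' h.
- by move=> h m; exact: pointed_dominated r_gt0 (s_pointed h).
- by move=> h m; exact: pointed_dominated r'_gt0 (s_pointed' h).
- exact: LP_capE.
- by move=> h /L1P; apply: le_trans; rewrite ge_min lexx.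
- move=> h /L2P /=; rewrite (level_tropical d_gt0 t_seed _ lk).
  by apply: le_trans; rewrite ge_min lexx orbT.
- exact: BP.
- by move=> h /BP'.
- by lia.
Qed.
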